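(* Let $X$ be a smooth complete curve over an algebraically closed field $K$ of characteristic $0$. Let $\omega,\eta$ be forms of the second kind on $X$, and let $[\omega],[\eta]$ be their respective cohomology classes in $H^1_{\mathrm{dR}}(X/K)$. Then $$\mathrm{tr}([\omega]\cup[\eta])=\sum_x\mathrm{res}_x\Bigl(\bigl(\textstyle\int\omega\bigr)\cdot\eta\Bigr),$$ where $x$ runs over the closed points of $X$.
   Context: $X$ is connected with function field $K(X)$. A meromorphic $1$-form is of the second kind if all its residues are $0$. $\int\omega$ at $x$ is the Laurent series obtained by termwise integration of a local expansion of $\omega$ at $x$; it is determined up to a constant, which does not change the expression because $\mathrm{res}_x(\eta)=0$. Class of a form of the second kind: let $T^\bullet$ be the complex of flasque sheaves with $T^0=K(X)$, $T^1=\bigl(\bigoplus_{x}i_{x,*}K(X)/\mathcal{O}_{X,x}\bigr)\oplus\Omega^1_{K(X)}$, $T^2=\bigoplus_xi_{x,*}\Omega^1_{K(X)}/\Omega^1_{X,x}$ ($x$ over closed points) and differentials $f\mapsto((f_x)_x,df)$, $((g_x)_x,\omega)\mapsto(dg_x-\omega_x)_x$. The natural map $\Omega^\bullet_X\to T^\bullet$ gives $H^i_{\mathrm{dR}}(X/K)\cong H^i(\Gamma(X,T^\bullet))$. For $\omega$ of the second kind there are unique $f_x\in K(X)/\mathcal{O}_{X,x}$ with $\omega\equiv df_x$ modulo regular forms at $x$, and $[\omega]$ is the class of $((f_x)_x,\omega)$. In terms of Čech cocycles for a finite affine open covering $(U_i)$, a class in $H^1_{\mathrm{dR}}$ is given by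 $(\omega_i,f_{ij})$ with $\omega_i\in\Omega^1(U_i)$, $f_{ij}\in\mathcal{O}(U_{ij})$, $\omega_j-\omega_i=df_{ij}$ and the cocycle condition on $f_{ij}$; a class in $H^2_{\mathrm{dR}}$ by $(\omega_{ij},f_{ijk})$ with $\omega_{jk}-\omega_{ik}+\omega_{ij}=-df_{ijk}$ and the cocycle condition on $f_{ijk}$. The form $\omega$ corresponds to $(\omega+df_i,\,f_j-f_i)$ for any $f_i\in K(X)$ such that $\omega+df_i$ is regular on $U_i$. The cup product of $(\omega_i,f_{ij})$ and $(\eta_i,g_{ij})$ has $\Omega^1(U_{ij})$-component $-\omega_ig_{ij}+f_{ij}\eta_j$. The trace map $\mathrm{tr}:H^2_{\mathrm{dR}}(X/K)\to K$ is the inverse of the isomorphism $H^1(X,\Omega^1_X)\to H^2_{\mathrm{dR}}(X/K)$ followed by the trace map of Serre duality; explicitly, under $H^2_{\mathrm{dR}}(X/K)\cong H^2(\Gamma(X,T^\bullet))$, $\mathrm{tr}((\omega_x)_x)=-\sum_x\mathrm{res}_x(\omega_x)$. Čech cohomology and $H^*(\Gamma(X,T^\bullet))$ are compared inside the total Čech complex of $T^\bullet$, whose differentials in degrees $0$ and $1$ are $(f_i)\mapsto(f_{i,x},df_i,f_j-f_i)$ and $(g_{i,x},\omega_i,f_{ij})\mapsto(dg_{i,x}-(\omega_i)_x,\ g_{j,x}-g_{i,x}-f_{ij,x},\ \omega_j-\omega_i-df_{ij},\ f_{jk}-f_{ik}+f_{ij})$. *)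

(* Defs.v *)
(* The smooth complete connected curve X is handled as the abstract
   nonsingular curve of its function field F = K(X): the closed points are
   the discrete valuations of F / K (Hartshorne, Algebraic Geometry, I.6), the
   nonempty open subsets are the cofinite sets of closed points, O(U) is the
   set of f in F regular at all points of U, and Omega^1(U) is the set of
   meromorphic forms regular at all points of U. *)
From HB Require Import structures.
From mathcomp Require Import all_boot all_order all_algebra.
From mathcomp Require Import boolp classical_sets functions cardinality fsbigop.

Set Implicit Arguments.
Unset Strict Implicit.
Unset Printing Implicit Defensive.

Import Order.TTheory GRing.Theory Num.Theory.
Local Open Scope classical_set_scope.
Local Open Scope quotient_scope.
Local Open Scope ring_scope.

Definition poly_at (K F : fieldType) (i : {rmorphism K -> F})
  (p : {poly K}) (t : F) : F := (map_poly i p).[t].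

(* F is a finite extension of K(t) for some t transcendental over K. *)
Definition function_field_one_var (K F : fieldType) (i : {rmorphism K -> F}) :=
  exists t : F,
    (forall p : {poly K}, p != 0 -> poly_at i p t != 0) /\
    exists (n : nat) (b : 'I_n -> F), forall f : F,
      exists p q : 'I_n -> {poly K}, (forall k, q k != 0) /\
        f = \sum_(k < n) poly_at i (p k) t / poly_at i (q k) t * b k.

Definition derivation_over (K F : fieldType) (i : {rmorphism K -> F})
    (M : lmodType F) (D : F -> M) :=
  [/\ forall f g, D (f + g) = D f + D g,
      forall f g, D (f * g) = f *: D g + g *: D f
    & forall c, D (i c) = 0].

(* (Om, d) is the module of Kaehler differentials of F / K. *)
Definition universal_derivation (K F : fieldType) (i : {rmorphism K -> F})
    (Om : lmodType F) (d : F -> Om) :=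
  derivation_over i d /\
  forall (M : lmodType F) (D : F -> M), derivation_over i D ->
    exists phi : {linear Om -> M}, D =1 phi \o d /\
      forall psi : {linear Om -> M}, D =1 psi \o d -> psi =1 phi.

Record curve (K : closedFieldType) := Curve {
  ratfun : fieldType;
  kconst : {rmorphism K -> ratfun};
  meroform : lmodType ratfun;
  df : ratfun -> meroform;
  ratfunP : function_field_one_var kconst;
  formP : universal_derivation kconst df
}.
Arguments kconst {K} X : rename.
Arguments df {K X} f : rename.

Section Points.
Variables (K : closedFieldType) (X : curve K).
Local Notation F := (ratfun X).

(* [ordp x 0] is set to 0, instead of +oo, so that a point is determined by its
   valuation ring; order conditions on f therefore treat f = 0 apart. *)
Record closed_point := ClosedPoint {
  ordp :> F -> int;
  ordp0 : ordp 0 = 0;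
  ordpM : forall f g, f != 0 -> g != 0 -> ordp (f * g) = ordp f + ordp g;
  ordpD : forall f g, f != 0 -> g != 0 -> f + g != 0 ->
    Num.min (ordp f) (ordp g) <= ordp (f + g);
  ordpC : forall c : K, ordp (kconst X c) = 0;
  ordp_surj : exists t, ordp t = 1
}.

HB.instance Definition _ := gen_eqMixin closed_point.
HB.instance Definition _ := gen_choiceMixin closed_point.

Definition ordp_ge (x : closed_point) (n : int) (f : F) := f = 0 \/ n <= ordp x f.

Definition regular (x : closed_point) (f : F) := ordp_ge x 0 f.

(* Omega^1_{X,x} is the O_{X,x}-submodule generated by d(O_{X,x}). *)
Definition form_regular (x : closed_point) (w : meroform X) :=
  exists (n : nat) (f g : 'I_n -> F),
    (forall k, regular x (f k) /\ regular x (g k)) /\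
    w = \sum_(k < n) f k *: df (g k).

Definition uniformizer (x : closed_point) : F :=
  xget 0 [set t | ordp x t = 1].

(* A Laurent series over K is given by its coefficients int -> K, which vanish
   in all sufficiently negative degrees. *)
Definition is_expansion (x : closed_point) (f : F) (a : int -> K) :=
  exists m : int, (forall n, n < m -> a n = 0) /\
    forall N : nat, ordp_ge x (m + N%:Z)
      (f - \sum_(k < N) kconst X (a (m + k%:Z)) * uniformizer x ^ (m + k%:Z)).

Definition expansion (x : closed_point) (f : F) : int -> K :=
  xget (fun _ => 0) [set a | is_expansion x f a].

(* The series h such that w = h dt at x, for t the chosen uniformizer. *)
Definition form_expansion (x : closed_point) (w : meroform X) : int -> K :=
  expansion x (xget 0 [set h | w = h *: df (uniformizer x)]).

Definition laurent_mul (a b : int -> K) : int -> K :=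
  fun n => \sum_(k \in [set: int]) a k * b (n - k).

(* The primitive of h dt with constant term 0. *)
Definition laurent_int (a : int -> K) : int -> K :=
  fun n => if n == 0 then 0 else a (n - 1) / n%:~R.

(* The residue of h dt. *)
Definition laurent_res (a : int -> K) : K := a (-1).

Definition residue (x : closed_point) (w : meroform X) : K := laurent_res (form_expansion x w).

Definition second_kind (w : meroform X) := forall x : closed_point, residue x w = 0.

Lemma regular0 x : regular x 0. Proof. by left. Qed.

Lemma regularM x f g : regular x f -> regular x g -> regular x (f * g).
Proof.
have [-> _ _|f0] := eqVneq f 0; first by rewrite mul0r; left.
have [-> _ _|g0] := eqVneq g 0; first by rewrite mulr0; left.
case=> [/eqP|fx]; first by rewrite (negbTE f0).
case=> [/eqP|gx]; first by rewrite (negbTE g0).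
by right; rewrite ordpM// addr_ge0.
Qed.

Lemma regularD x f g : regular x f -> regular x g -> regular x (f + g).
Proof.
have [-> _|f0] := eqVneq f 0; first by rewrite add0r.
have [-> + _|g0] := eqVneq g 0; first by rewrite addr0.
have [-> _ _|fg0] := eqVneq (f + g) 0; first by left.
case=> [/eqP|fx]; first by rewrite (negbTE f0).
case=> [/eqP|gx]; first by rewrite (negbTE g0).
by right; apply: le_trans (ordpD x f0 g0 fg0); rewrite le_min fx gx.
Qed.

Lemma regularN x f : regular x f -> regular x (- f).
Proof.
move=> fx; rewrite -mulN1r; apply: regularM => //; right.
by rewrite -(rmorph1 (kconst X)) -rmorphN ordpC.
Qed.

Lemma regularB x f g : regular x f -> regular x g -> regular x (f - g).
Proof. by move=> fx gx; apply: regularD => //; exact: regularN. Qed.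

Lemma form_regular0 x : form_regular x 0.
Proof.
exists 0%N, (fun _ => 0), (fun _ => 0); split; last by rewrite big_ord0.
by case.
Qed.

Lemma form_regularZ x f w :
  regular x f -> form_regular x w -> form_regular x (f *: w).
Proof.
move=> fx [n [a [b [ab ->]]]]; exists n, (fun k => f * a k), b; split.
  by move=> k; have [ak bk] := ab k; split => //; exact: regularM.
by rewrite scaler_sumr; apply: eq_bigr => k _; rewrite scalerA.
Qed.

Lemma form_regularN x w : form_regular x w -> form_regular x (- w).
Proof.
move=> wx; rewrite -scaleN1r; apply: form_regularZ => //.
by apply: regularN; right; rewrite -(rmorph1 (kconst X)) ordpC.
Qed.

Lemma form_regularD x w w' :
  form_regular x w -> form_regular x w' -> form_regular x (w + w').
Proof.
move=> [n [a [b [ab ->]]]] [n' [a' [b' [ab' ->]]]].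
exists (n + n')%N,
  (fun k => match fintype.split k with inl i => a i | inr i => a' i end),
  (fun k => match fintype.split k with inl i => b i | inr i => b' i end).
split; first by move=> k; case: (fintype.split k).
rewrite big_split_ord/=; congr (_ + _); apply: eq_bigr => k _.
  by rewrite (unsplitK (inl k)).
by rewrite (unsplitK (inr k)).
Qed.

Lemma form_regularB x w w' :
  form_regular x w -> form_regular x w' -> form_regular x (w - w').
Proof. by move=> wx w'x; apply: form_regularD => //; exact: form_regularN. Qed.

Lemma dfD (f g : F) : df (f + g) = df f + df g :> meroform X.
Proof. by have [[h _ _] _] := formP X; exact: h. Qed.

Lemma dfM (f g : F) : df (f * g) = f *: df g + g *: df f :> meroform X.
Proof. by have [[_ h _] _] := formP X; exact: h. Qed.

Lemma dfC c : df (kconst X c) = 0 :> meroform X.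
Proof. by have [[_ _ h] _] := formP X; exact: h. Qed.

Lemma df0 : df 0 = 0 :> meroform X.
Proof. by rewrite -(rmorph0 (kconst X)) dfC. Qed.

Lemma dfN (f : F) : df (- f) = - df f :> meroform X.
Proof. by apply/eqP; rewrite -addr_eq0 -dfD addNr df0. Qed.

Lemma dfB (f g : F) : df (f - g) = df f - df g :> meroform X.
Proof. by rewrite dfD dfN. Qed.

End Points.

(* De Rham cohomology is H^i(Gamma(X, T)), for the flasque resolution T of the
   de Rham complex with T^0 = K(X),
     T^1 = (+)_x i_{x,*} K(X) / O_{X,x}  (+)  Omega^1_{K(X)},
     T^2 = (+)_x i_{x,*} Omega^1_{K(X)} / Omega^1_{X,x}
   and differentials f |-> ((f_x)_x, df), ((g_x)_x, w) |-> (dg_x - w_x)_x.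
   A family (g_x) in
   (+)_x F / O_{X,x} is represented by a family of lifts g_x in F, all but
   finitely many of which are regular; likewise for (+)_x Omega / Omega_{X,x}.
   The equivalence relations below therefore hold modulo O_{X,x} and
   Omega_{X,x} as well as modulo coboundaries. *)
Section DeRham.
Variables (K : closedFieldType) (X : curve K).
Local Notation F := (ratfun X).

(* ((g_x)_x, w) in Gamma(X, T^1) with zero differential. *)
Record cocycle1 := Cocycle1 {
  pp1 : closed_point X -> F;
  form1 : meroform X;
  pp1_finite : finite_set [set x | ~ regular x (pp1 x)];
  cocycle1P : forall x, form_regular x (df (pp1 x) - form1)
}.

HB.instance Definition _ := gen_eqMixin cocycle1.
HB.instance Definition _ := gen_choiceMixin cocycle1.

Definition cohomologous1 (z z' : cocycle1) :=
  exists f : F, (forall x, regular x (pp1 z x - pp1 z' x - f)) /\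
    form1 z - form1 z' = df f.

Lemma cohomologous1_refl : reflexive (fun z z' => `[< cohomologous1 z z' >]).
Proof.
move=> z; apply/asboolP; exists 0; split; last by rewrite subrr df0.
by move=> x; rewrite subrr subr0; exact: regular0.
Qed.

Lemma cohomologous1_sym : symmetric (fun z z' => `[< cohomologous1 z z' >]).
Proof.
suff h z z' : cohomologous1 z z' -> cohomologous1 z' z.
  by move=> z z'; apply/asboolP/asboolP; exact: h.
move=> [f [fx fw]]; exists (- f); split; last by rewrite dfN -fw opprB.
by move=> x; rewrite -(opprB (pp1 z x)) -opprD; exact: regularN.
Qed.

Lemma cohomologous1_trans : transitive (fun z z' => `[< cohomologous1 z z' >]).
Proof.
move=> z2 z1 z3 /asboolP[f [fx fw]] /asboolP[g [gx gw]].
apply/asboolP; exists (f + g); split; last by rewrite dfD -fw -gw addrA subrK.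
by move=> x; have := regularD (fx x) (gx x); rewrite addrACA -opprD addrA subrK.
Qed.

Definition cohomologous1_equiv :=
  EquivRel (fun z z' => `[< cohomologous1 z z' >])
    cohomologous1_refl cohomologous1_sym cohomologous1_trans.

Definition HdR1 := {eq_quot cohomologous1_equiv}.

(* (c_x)_x in Gamma(X, T^2). *)
Record cocycle2 := Cocycle2 {
  pp2 :> closed_point X -> meroform X;
  pp2_finite : finite_set [set x | ~ form_regular x (pp2 x)]
}.

HB.instance Definition _ := gen_eqMixin cocycle2.
HB.instance Definition _ := gen_choiceMixin cocycle2.

Definition cohomologous2 (c c' : cocycle2) :=
  exists (g : closed_point X -> F) (s : meroform X),
    finite_set [set x | ~ regular x (g x)] /\
    forall x, form_regular x (c x - c' x - (df (g x) - s)).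

Lemma cohomologous2_refl : reflexive (fun c c' => `[< cohomologous2 c c' >]).
Proof.
move=> c; apply/asboolP; exists (fun _ => 0), 0; split.
  by apply: sub_finite_set (finite_set0 _) => x /= []; exact: regular0.
by move=> x; rewrite df0 subrr !subr0; exact: form_regular0.
Qed.

Lemma cohomologous2_sym : symmetric (fun c c' => `[< cohomologous2 c c' >]).
Proof.
suff h c c' : cohomologous2 c c' -> cohomologous2 c' c.
  by move=> c c'; apply/asboolP/asboolP; exact: h.
move=> [g [s [gf gs]]]; exists (fun x => - g x), (- s); split.
  apply: sub_finite_set gf => x /= gx fx; apply: gx.
  exact: regularN.
by move=> x; rewrite dfN -(opprB (c x)) -!opprD; exact: form_regularN.
Qed.

Lemma cohomologous2_trans : transitive (fun c c' => `[< cohomologous2 c c' >]).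
Proof.
move=> c2 c1 c3 /asboolP[g [s [gf gs]]] /asboolP[g' [s' [gf' gs']]].
apply/asboolP; exists (fun x => g x + g' x), (s + s'); split.
  have gfU : finite_set ([set x | ~ regular x (g x)] `|`
      [set x | ~ regular x (g' x)]) by rewrite finite_setU.
  apply: sub_finite_set gfU => x /= gg'x.
  have [gx|gx] := pselect (regular x (g x)); last by left.
  by right => g'x; apply: gg'x; exact: regularD.
move=> x; have := form_regularD (gs x) (gs' x).
by rewrite dfD addrACA -opprD addrA subrK (addrACA (df _)) -opprD.
Qed.

Definition cohomologous2_equiv :=
  EquivRel (fun c c' => `[< cohomologous2 c c' >])
    cohomologous2_refl cohomologous2_sym cohomologous2_trans.

Definition HdR2 := {eq_quot cohomologous2_equiv}.

Lemma zero_cocycle1_finite :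
  finite_set [set x : closed_point X | ~ regular x (0 : F)].
Proof. by apply: sub_finite_set (finite_set0 _) => x /= []; exact: regular0. Qed.

Lemma zero_cocycle1P (x : closed_point X) : form_regular x (df 0 - 0).
Proof. by rewrite df0 subrr; exact: form_regular0. Qed.

Definition zero_cocycle1 := Cocycle1 zero_cocycle1_finite zero_cocycle1P.

Lemma zero_cocycle2_finite :
  finite_set [set x : closed_point X | ~ form_regular x (0 : meroform X)].
Proof.
by apply: sub_finite_set (finite_set0 _) => x /= []; exact: form_regular0.
Qed.

Definition zero_cocycle2 := Cocycle2 zero_cocycle2_finite.

(* The class of ((f_x)_x, w); for w of the second kind the f_x modulo O_{X,x}
   exist and are unique. *)
Definition dR_class (w : meroform X) : HdR1 :=
  xget (\pi_HdR1 zero_cocycle1)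
    [set \pi_HdR1 z | z in [set z : cocycle1 | form1 z = w]].

(* Under the identification with H^2(Gamma(X, T)), the inverse of
   H^1(X, Omega^1) -> H^2_dR followed by the trace map of Serre duality sends
   the class of (c_x)_x to - sum_x res_x(c_x). This is independent of the
   representative because residues vanish on Omega_{X,x} and on exact forms,
   and the residues of a meromorphic form sum to 0. *)
Definition dR_trace (c : HdR2) : K :=
  - \sum_(x \in [set: closed_point X]) residue x (repr c x).

(* An open subset of X is affine and nonempty if and only if it is cofinite and
   different from X. *)
Record affine_cover := AffineCover {
  cover_size : nat;
  cover_open :> 'I_cover_size -> set (closed_point X);
  cover_cofinite : forall i, finite_set (~` cover_open i);
  cover_proper : forall i, cover_open i != setT;
  cover_covers : forall x, exists i, cover_open i x
}.
Arguments cover_open : clear implicits.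

Record cech1 (U : affine_cover) := Cech1 {
  cech1_form : 'I_(cover_size U) -> meroform X;
  cech1_fun : 'I_(cover_size U) -> 'I_(cover_size U) -> F;
  cech1_form_regular : forall i x, U i x -> form_regular x (cech1_form i);
  cech1_fun_regular : forall i j x, U i x -> U j x -> regular x (cech1_fun i j);
  cech1_form_cocycle : forall i j,
    cech1_form j - cech1_form i = df (cech1_fun i j);
  cech1_fun_cocycle : forall i j k,
    cech1_fun j k - cech1_fun i k + cech1_fun i j = 0
}.

Record cech2 (U : affine_cover) := Cech2 {
  cech2_form : 'I_(cover_size U) -> 'I_(cover_size U) -> meroform X;
  cech2_fun :
    'I_(cover_size U) -> 'I_(cover_size U) -> 'I_(cover_size U) -> F;
  cech2_form_regular : forall i j x, U i x -> U j x ->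
    form_regular x (cech2_form i j);
  cech2_fun_regular : forall i j k x, U i x -> U j x -> U k x ->
    regular x (cech2_fun i j k);
  cech2_form_cocycle : forall i j k,
    cech2_form j k - cech2_form i k + cech2_form i j = - df (cech2_fun i j k);
  cech2_fun_cocycle : forall i j k l,
    cech2_fun j k l - cech2_fun i k l + cech2_fun i j l - cech2_fun i j k = 0
}.

(* The Cech cocycle and the class have the same image in the cohomology of the
   total Cech complex of T: their difference is the differential of
   (u_i) in C^0(U, T^0). *)
Definition cech1_represents (U : affine_cover) (a : cech1 U) (h : HdR1) :=
  exists2 z : cocycle1, h = \pi_HdR1 z &
    exists u : 'I_(cover_size U) -> F,
      [/\ forall i x, U i x -> regular x (- pp1 z x - u i),
          forall i, cech1_form a i - form1 z = df (u i)
        & forall i j, cech1_fun a i j = u j - u i].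

(* The same in degree 2; the difference is the differential of
   ((g_{i,x}, s_i), p_ij) in C^0(U, T^1) (+) C^1(U, T^0). *)
Definition cech2_represents (U : affine_cover) (b : cech2 U) (h : HdR2) :=
  exists2 c : cocycle2, h = \pi_HdR2 c &
    exists (g : 'I_(cover_size U) -> closed_point X -> F)
           (s : 'I_(cover_size U) -> meroform X)
           (p : 'I_(cover_size U) -> 'I_(cover_size U) -> F),
      (forall i, finite_set [set x | U i x /\ ~ regular x (g i x)]) /\
      [/\ forall i x, U i x -> form_regular x (- c x - (df (g i x) - s i)),
          forall i j x, U i x -> U j x -> regular x (g j x - g i x - p i j),
          forall i j, cech2_form b i j = s j - s i - df (p i j)
        & forall i j k, cech2_fun b i j k = p j k - p i k + p i j].

Section CechCup.
Variables (U : affine_cover) (a b : cech1 U).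

Definition cup_form i j : meroform X :=
  - (cech1_fun b i j *: cech1_form a i) + cech1_fun a i j *: cech1_form b j.

Definition cup_fun i j k : F := cech1_fun a i j * cech1_fun b j k.

Lemma cup_form_regular i j x : U i x -> U j x -> form_regular x (cup_form i j).
Proof.
move=> ix jx; apply: form_regularD; first apply: form_regularN.
all: apply: form_regularZ; first exact: cech1_fun_regular.
all: exact: cech1_form_regular.
Qed.

Lemma cup_fun_regular i j k x :
  U i x -> U j x -> U k x -> regular x (cup_fun i j k).
Proof. by move=> ix jx kx; apply: regularM; exact: cech1_fun_regular. Qed.

Let funE (c : cech1 U) i j k :
  cech1_fun c i k = cech1_fun c i j + cech1_fun c j k.
Proof.
by rewrite -[LHS]addr0 -(cech1_fun_cocycle c i j k) addrA (addrC _ (_ - _)) subrK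
  addrC.
Qed.

Lemma cup_form_cocycle i j k :
  cup_form j k - cup_form i k + cup_form i j = - df (cup_fun i j k).
Proof.
rewrite /cup_form /cup_fun dfM -!cech1_form_cocycle (funE a i j k) (funE b i j k).
rewrite !scalerBr !scalerDl !opprD !opprK !addrA.
rewrite [LHS](ACl (2*6*3*7*1*4*5*8))/= subrr add0r subrr add0r.
by rewrite [RHS](ACl (3*4*1*2))/=.
Qed.

Lemma cup_fun_cocycle i j k l :
  cup_fun j k l - cup_fun i k l + cup_fun i j l - cup_fun i j k = 0.
Proof.
rewrite /cup_fun (funE a i j k) (funE b j k l) mulrDl mulrDr opprD !addrA.
by rewrite [LHS](ACl (1*3*2*5*4*6))/= subrr add0r addNr add0r subrr.
Qed.

(* The component in O(U_ijk) is the one which makes the given component in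
   Omega^1(U_ij) a cocycle. *)
Definition cech_cup : cech2 U :=
  Cech2 cup_form_regular cup_fun_regular cup_form_cocycle cup_fun_cocycle.

End CechCup.

(* Computed on Cech cocycles; the result depends neither on the covering nor on
   the cocycles. *)
Definition dR_cup (h h' : HdR1) : HdR2 :=
  xget (\pi_HdR2 zero_cocycle2)
    [set c | exists U (a b : cech1 U),
      [/\ cech1_represents a h, cech1_represents b h'
        & cech2_represents (cech_cup a b) c]].

End DeRham.

(* Main.v *)
Require Import Defs.
From HB Require Import structures.
From mathcomp Require Import all_boot all_order all_algebra.
From mathcomp Require Import boolp classical_sets cardinality fsbigop.
From mathcomp Require Import zify ring.

(* The class of the cup product is represented by the forms
   s_i = - v_i w + u_i eta + u_i dv_i on the open sets U_i of a covering, where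
   w + du_i and eta + dv_i are regular on U_i. At a point of U_i integration by
   parts identifies the residue of s_i with that of - (int w) eta, up to the
   residue of a form which does not depend on i. As classes are only known up
   to coboundaries, everything rests on the residue theorem.

   A form can be written f dg, with f and g regular off the set S of poles of
   some function h. The commutator of multiplication by f and by g, compressed
   to the finite-dimensional space of functions with poles of order at most N
   on S, has trace zero; on the other hand this trace is computed by the basis
   elements of pole order close to N, which are prescribed by local expansions,
   and it equals the sum of the residues of f dg.

   The spaces are finite-dimensional because everywhere regular functions are
   constant: for u nonconstant, a maximal subring containing K and u in which u
   is not invertible is the ring of a discrete valuation positive at u. *)

Set Implicit Arguments.
Unset Strict Implicit.
Unset Printing Implicit Defensive.

Import Order.TTheory GRing.Theory Num.Theory.
Local Open Scope classical_set_scope.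
Local Open Scope quotient_scope.
Local Open Scope ring_scope.

(** * Valuations *)

Section Orders.
Variables (K : closedFieldType) (X : curve K).
Local Notation F := (ratfun X).
Local Notation cst := (kconst X).
Implicit Types (x y : closed_point X) (f g h : F) (n m : int).

(** A point is an abstract discrete valuation of the function field, so it has to be proved that
    residue fields are K, that poles are finite in number, and that there is a point at all. All
    three rest on [poly_dependent]: for each h there is an n such that any n + 1 functions satisfy a
    nontrivial relation with coefficients in K[h]. Local calculus is done on coefficient sequences,
    and a sequence counts as a function only if it is the expansion of an element of K(X).
    Derivatives therefore need a separable equation, which is where characteristic 0 first enters,
    and primitives are realized in K(X) only for polar parts. In the trace argument the exact
    dimensions of the spaces never matter. It is enough to find functions with prescribed polar
    parts up to an error whose pole order M does not depend on the prescription; if f and g have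
    poles of order at most c, then all coefficients of order beyond M + c are exact. *)

Lemma ordp1 x : x 1 = 0.
Proof. by rewrite -(rmorph1 cst) ordpC. Qed.

Lemma ordpN x f : x (- f) = x f.
Proof.
have [->|f0] := eqVneq f 0; first by rewrite oppr0.
rewrite -mulN1r ordpM ?oppr_eq0 ?oner_eq0//.
by rewrite -(rmorph1 cst) -rmorphN ordpC add0r.
Qed.

Lemma ordpV x f : x f^-1 = - x f.
Proof.
have [->|f0] := eqVneq f 0; first by rewrite invr0 ordp0 oppr0.
by apply/eqP; rewrite -addr_eq0 -ordpM ?invr_eq0// mulVf// ordp1.
Qed.

Lemma ordpX x f (k : nat) : x (f ^+ k) = x f *+ k.
Proof.
have [->|f0] := eqVneq f 0.
  by rewrite expr0n; case: eqP => _; rewrite ?ordp1 ordp0 ?mul0rn.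
elim: k => [|k IHk]; first by rewrite ordp1.
by rewrite exprS ordpM ?expf_neq0// IHk mulrS.
Qed.

Lemma ordpXz x f n : x (f ^ n) = x f * n.
Proof.
case: n => k; first by rewrite -exprnP ordpX -mulr_natr natz.
by rewrite NegzE -exprnN ordpV ordpX mulrN -mulr_natr natz.
Qed.

Lemma ordp_geE x n f : f != 0 -> ordp_ge x n f <-> n <= x f.
Proof.
by move=> f0; split=> [[/eqP|//]|]; [rewrite (negbTE f0)|right].
Qed.

Lemma ordp_geW x n m f : m <= n -> ordp_ge x n f -> ordp_ge x m f.
Proof. by move=> mn [->|nf]; [left|right; exact: le_trans nf]. Qed.

Lemma ordp_ge_ordp x f : ordp_ge x (x f) f.
Proof. by right. Qed.

Lemma ordp_geN x n f : ordp_ge x n f -> ordp_ge x n (- f).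
Proof. by case=> [->|nf]; [left; rewrite oppr0|right; rewrite ordpN]. Qed.

Lemma ordp_geD x n f g : ordp_ge x n f -> ordp_ge x n g -> ordp_ge x n (f + g).
Proof.
have [-> _|f0] := eqVneq f 0; first by rewrite add0r.
have [-> + _|g0] := eqVneq g 0; first by rewrite addr0.
have [-> _ _|fg0] := eqVneq (f + g) 0; first by left.
move=> /ordp_geE -/(_ f0) nf /ordp_geE -/(_ g0) ng; right.
by apply: le_trans (ordpD x f0 g0 fg0); rewrite le_min nf ng.
Qed.

Lemma ordp_geB x n f g : ordp_ge x n f -> ordp_ge x n g -> ordp_ge x n (f - g).
Proof. by move=> nf ng; apply: ordp_geD => //; exact: ordp_geN. Qed.

Lemma ordp_geM x n m f g :
  ordp_ge x n f -> ordp_ge x m g -> ordp_ge x (n + m) (f * g).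
Proof.
have [-> _ _|f0] := eqVneq f 0; first by rewrite mul0r; left.
have [-> _ _|g0] := eqVneq g 0; first by rewrite mulr0; left.
move=> /ordp_geE -/(_ f0) nf /ordp_geE -/(_ g0) mg; right.
by rewrite ordpM// lerD.
Qed.

Lemma ordp_ge_sum x n (I : Type) (r : seq I) (P : pred I) (f : I -> F) :
  (forall i, P i -> ordp_ge x n (f i)) -> ordp_ge x n (\sum_(i <- r | P i) f i).
Proof.
by move=> fP; elim/big_ind: _ => //; [left|exact: ordp_geD].
Qed.

Lemma ordp_ge_cst x c : ordp_ge x 0 (cst c).
Proof. by right; rewrite ordpC. Qed.

Lemma ordp_ge1 x : ordp_ge x 0 1.
Proof. by rewrite -(rmorph1 cst); exact: ordp_ge_cst. Qed.

Lemma ordp_geX x n f (k : nat) : ordp_ge x n f -> ordp_ge x (n *+ k) (f ^+ k).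
Proof.
move=> nf; elim: k => [|k IHk]; first exact: ordp_ge1.
by rewrite exprS mulrS; exact: ordp_geM.
Qed.

Lemma ordp_geCl x n c f : ordp_ge x n f -> ordp_ge x n (cst c * f).
Proof. by move=> nf; rewrite -[n]add0r; apply: ordp_geM nf; exact: ordp_ge_cst. Qed.

Lemma ordp_ge_eq0 x f : (forall n, ordp_ge x n f) -> f = 0.
Proof.
move=> h; apply: contrapT => /eqP f0.
by have /ordp_geE -/(_ f0) := h (x f + 1); rewrite gerDl.
Qed.

Lemma cst_ordp_ge1 x c : ordp_ge x 1 (cst c) -> c = 0.
Proof. by case=> [/eqP|]; [rewrite fmorph_eq0 => /eqP|rewrite ordpC]. Qed.

(** The term of strictly smaller order cannot be cancelled. *)
Lemma ordp_eqD x f g : f != 0 -> ordp_ge x (x f + 1) g ->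
  f + g != 0 /\ x (f + g) = x f.
Proof.
move=> f0 gx; have fgx : ~ ordp_ge x (x f + 1) (f + g).
  move=> /ordp_geB -/(_ _ gx); rewrite addrK => /ordp_geE -/(_ f0).
  by rewrite gerDl.
have fg0 : f + g != 0 by apply/eqP => fg0; apply: fgx; rewrite fg0; left.
split=> //; apply/le_anti/andP; split.
  rewrite leNgt -lezD1; apply/negP => h; apply: fgx; right.
  exact: h.
apply/(ordp_geE _ _ fg0); apply: ordp_geD; first by right.
by apply: ordp_geW gx; rewrite lerDl.
Qed.

Lemma ordp_uniformizer x : x (uniformizer x) = 1.
Proof. exact: (@xgetPex _ 0 [set t | x t = 1] (ordp_surj x)). Qed.

Lemma uniformizer_neq0 x : uniformizer x != 0.
Proof.
by apply/eqP => t0; have := ordp_uniformizer x; rewrite t0 ordp0 => /eqP.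
Qed.

Lemma ordp_uniformizerXz x n : x (uniformizer x ^ n) = n.
Proof. by rewrite ordpXz ordp_uniformizer mul1r. Qed.

Lemma ordp_ge_uniformizerXz x n : ordp_ge x n (uniformizer x ^ n).
Proof. by right; rewrite ordp_uniformizerXz. Qed.

Lemma uniformizerXz_neq0 x n : uniformizer x ^ n != 0.
Proof. by rewrite expfz_neq0// uniformizer_neq0. Qed.

End Orders.

(** * Algebraic relations in the function field *)

Lemma exists_null_combination (K : fieldType) (I J : finType) (A : I -> J -> K) :
  (#|J| < #|I|)%N ->
  exists u : I -> K, (exists i, u i != 0) /\ forall j, \sum_i u i * A i j = 0.
Proof.
move=> JI; pose M := \matrix_(i < #|I|, j < #|J|) A (enum_val i) (enum_val j).
have /rowV0Pn[v /sub_kermxP vM v0] : kermx M != 0.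
  rewrite kermx_eq0 -row_leq_rank -ltnNge; apply: leq_ltn_trans JI.
  exact: rank_leq_col.
exists (fun i => v 0 (enum_rank i)); split.
  by have [j vj] := rV0Pn _ v0; exists (enum_val j); rewrite enum_valK.
move=> j; have /matrixP/(_ 0 (enum_rank j)) := vM.
rewrite !mxE => vMj; rewrite -[RHS]vMj (reindex_onto enum_val enum_rank)/=.
  by apply: eq_big => [i|i _]; rewrite ?enum_valK ?eqxx// mxE enum_rankK.
by move=> i _; rewrite enum_rankK.
Qed.

Section Evaluation.
Variables (K F : fieldType) (i : {rmorphism K -> F}) (t : F).
Implicit Types (p q : {poly K}) (c : K).
Local Notation at_t p := (poly_at i p t).

Lemma poly_at0 : at_t 0 = 0. Proof. by rewrite /poly_at rmorph0 horner0. Qed.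

Lemma poly_atD p q : at_t (p + q) = at_t p + at_t q.
Proof. by rewrite /poly_at rmorphD hornerD. Qed.

Lemma poly_atN p : at_t (- p) = - at_t p.
Proof. by rewrite /poly_at rmorphN hornerN. Qed.

Lemma poly_atB p q : at_t (p - q) = at_t p - at_t q.
Proof. by rewrite poly_atD poly_atN. Qed.

Lemma poly_atM p q : at_t (p * q) = at_t p * at_t q.
Proof. by rewrite /poly_at rmorphM hornerM. Qed.

Lemma poly_atC c : at_t c%:P = i c.
Proof. by rewrite /poly_at map_polyC hornerC. Qed.

Lemma poly_at1 : at_t 1 = 1. Proof. by rewrite poly_atC rmorph1. Qed.

Lemma poly_at_X : at_t 'X = t.
Proof. by rewrite /poly_at map_polyX hornerX. Qed.

Lemma poly_atXn p n : at_t (p ^+ n) = at_t p ^+ n.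
Proof. by rewrite /poly_at rmorphXn horner_exp. Qed.

Lemma poly_atZ c p : at_t (c *: p) = i c * at_t p.
Proof. by rewrite -mul_polyC poly_atM poly_atC. Qed.

Lemma poly_at_sum (I : Type) (r : seq I) (P : pred I) (p : I -> {poly K}) :
  at_t (\sum_(j <- r | P j) p j) = \sum_(j <- r | P j) at_t (p j).
Proof. exact: (big_morph _ poly_atD poly_at0). Qed.

Lemma poly_at_prod (I : Type) (r : seq I) (P : pred I) (p : I -> {poly K}) :
  at_t (\prod_(j <- r | P j) p j) = \prod_(j <- r | P j) at_t (p j).
Proof. exact: (big_morph _ poly_atM poly_at1). Qed.

Lemma poly_at_poly n (a : nat -> K) :
  at_t (\poly_(j < n) a j) = \sum_(j < n) i (a j) * t ^+ j.
Proof.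
rewrite poly_def poly_at_sum; apply: eq_bigr => j _.
by rewrite poly_atZ poly_atXn poly_at_X.
Qed.

Lemma poly_at_coef p : at_t p = \sum_(j < size p) i p`_j * t ^+ j.
Proof. by rewrite -[in LHS](coefK p) poly_at_poly. Qed.

End Evaluation.

Section FunctionField.
Variables (K : closedFieldType) (X : curve K).
Local Notation F := (ratfun X).
Local Notation cst := (kconst X).
Local Notation "p .<[ t ]>" := (poly_at cst p t) (at level 2, left associativity).
Implicit Types (f g h t : F).

(* The monomials [h ^ j * v i], for [j] at most [J], lie in a K-space whose
   dimension grows at most as [n * C * J], where n is the number of generators
   over K(t) and C bounds the degrees in the matrix of multiplication by h. *)
Lemma poly_dependent h : exists n, forall v : 'I_n.+1 -> F,
  exists c : 'I_n.+1 -> {poly K}, (exists i, c i != 0) /\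
    \sum_i (c i).<[h]> * v i = 0.
Proof.
have [t [tP [n [b bP]]]] := ratfunP X.
have clear f : exists Q, Q != 0 /\ exists p : 'I_n -> {poly K},
    Q.<[t]> * f = \sum_k (p k).<[t]> * b k.
  have [p [q [q0 ->]]] := bP f.
  exists (\prod_k q k); split; first by apply/prodf_neq0 => k _; exact: q0.
  exists (fun k => p k * \prod_(j | j != k) q j); rewrite mulr_sumr.
  apply: eq_bigr => k _; rewrite (bigD1 k)//= !poly_atM.
  by field; rewrite tP.
(* [V D] is spanned over K by n D elements: the coordinates in [b] are polynomials in t with at most
   [D] coefficients. *)
pose V D f := exists2 p : 'I_n -> {poly K}, forall k, (size (p k) <= D)%N &
  f = \sum_k (p k).<[t]> * b k.
have clearV (I : finType) (v : I -> F) : exists Q, Q != 0 /\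
    exists D, forall i, V D (Q.<[t]> * v i).
  have [Q QP] := choice (fun i => clear (v i)).
  have [p pP] := choice (fun i => (QP i).2).
  exists (\prod_i Q i); split.
    by apply/prodf_neq0 => k _; exact: (QP _).1.
  pose r i k := (\prod_(j | j != i) Q j) * p i k.
  exists (\max_i \max_k size (r i k))%N => i; exists (r i).
    move=> k; apply: leq_trans (leq_bigmax i).
    exact: (leq_bigmax (F := fun k => size (r i k)) k).
  rewrite (bigD1 i)//= poly_atM mulrAC pP mulr_suml; apply: eq_bigr => k _.
  by rewrite /r poly_atM mulrC mulrA.
(* [Q] clears the denominators of the matrix of multiplication by [h], so multiplication by Q h,
   like multiplication by Q, raises the bound [D] by at most C. *)
have [Q [Q0 [C0 hb]]] := clearV _ (fun k => h * b k).
pose C := maxn C0 (size Q).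
have VW D f (s : nat) (q : {poly K}) : (size q <= s.+1)%N -> V D f ->
    V (D + s)%N (q.<[t]> * f).
  move=> qs [p pD ->]; exists (fun k => q * p k) => [k|].
    by apply: leq_trans (size_polyMleq _ _) _; move: (pD k) qs; lia.
  by rewrite mulr_sumr; apply: eq_bigr => k _; rewrite poly_atM mulrA.
have VD D f g : V D f -> V D g -> V D (f + g).
  move=> [p pD ->] [q qD ->]; exists (fun k => p k + q k) => [k|].
    by apply: leq_trans (size_polyD _ _) _; rewrite geq_max pD qD.
  by rewrite -big_split; apply: eq_bigr => k _; rewrite poly_atD mulrDl.
have VQ D f : V D f -> V (D + C)%N (Q.<[t]> * f).
  by apply: VW; rewrite (leq_trans (leq_maxr C0 (size Q))).
have Vh D f : V D f -> V (D + C)%N (Q.<[t]> * h * f).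
  move=> [p pD ->]; rewrite mulr_sumr; elim/big_ind: _ => [||k _].
  - exists (fun=> 0) => [k|]; first by rewrite size_poly0.
    by rewrite big1// => k _; rewrite poly_at0 mul0r.
  - exact: VD.
  - have -> : Q.<[t]> * h * ((p k).<[t]> * b k) =
        (p k).<[t]> * (Q.<[t]> * (h * b k)).
      by rewrite mulrCA !mulrA.
    rewrite addnC; have [q qC ->] := hb k; exists (fun l => p k * q l).
      move=> l; apply: leq_trans (size_polyMleq _ _) _.
      have := qC l; have := pD k; have := leq_maxl C0 (size Q).
      by rewrite -/C; lia.
    by rewrite mulr_sumr; apply: eq_bigr => l _; rewrite poly_atM mulrA.
exists (n * C)%N => v.
have [r [r0 [D rv]]] := clearV _ v.
(* There are (J + 1)(n C + 1) monomials and n (D + C J) coefficients to annihilate; with J = n D the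
   former number exceeds the latter by n C + 1. *)
pose J := (n * D)%N.
have VJ (j : nat) (i : 'I_(n * C).+1) : (j <= J)%N ->
    V (D + C * J)%N (r.<[t]> * Q.<[t]> ^+ J * (h ^+ j * v i)).
  move=> jJ; have -> : r.<[t]> * Q.<[t]> ^+ J * (h ^+ j * v i) =
      Q.<[t]> ^+ (J - j) * ((Q.<[t]> * h) ^+ j * (r.<[t]> * v i)).
    by rewrite -{1}(subnK jJ) exprD exprMn; ring.
  have -> : (D + C * J = D + C * j + C * (J - j))%N by nia.
  have : V (D + C * j)%N ((Q.<[t]> * h) ^+ j * (r.<[t]> * v i)).
    elim: j {jJ} => [|j IHj]; first by rewrite muln0 addn0 mul1r.
    by rewrite exprS -mulrA mulnS addnCA addnC; exact: Vh.
  elim: (J - j)%N => [|k IHk] Vj; first by rewrite muln0 addn0 mul1r.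
  by rewrite exprS -mulrA mulnS addnCA addnC; apply: VQ; exact: IHk.
have /choice[p pP] (ji : 'I_J.+1 * 'I_(n * C).+1) :
    exists p : 'I_n -> {poly K}, (forall k, (size (p k) <= D + C * J)%N) /\
    r.<[t]> * Q.<[t]> ^+ J * (h ^+ ji.1 * v ji.2) = \sum_k (p k).<[t]> * b k.
  by have [|p pD ->] := VJ ji.1 ji.2; [rewrite -ltnS|exists p].
have [|u [[[j0 i0] u0] uA]] := @exists_null_combination K _ _
  (fun ji (kd : 'I_n * 'I_(D + C * J)) => (p ji kd.1)`_kd.2).
  by rewrite !card_prod !card_ord /J; nia.
exists (fun i => \poly_(j < J.+1) u (inord j, i)); split.
  exists i0; apply/eqP => /polyP/(_ j0); rewrite coef_poly ltn_ord coef0.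
  by rewrite inord_val; apply/eqP.
have rQ0 : r.<[t]> * Q.<[t]> ^+ J != 0.
  by rewrite mulf_neq0 ?expf_neq0// tP.
apply: (mulfI rQ0); rewrite mulr0.
transitivity (\sum_ji cst (u ji) * (r.<[t]> * Q.<[t]> ^+ J * (h ^+ ji.1 * v ji.2))).
  transitivity (\sum_j \sum_i cst (u (j, i)) *
      (r.<[t]> * Q.<[t]> ^+ J * (h ^+ j * v i))).
    rewrite exchange_big mulr_sumr; apply: eq_bigr => i _.
    rewrite poly_at_poly mulr_suml mulr_sumr.
    by apply: eq_bigr => j _; rewrite inord_val; ring.
  by rewrite pair_bigA; apply: eq_bigr => -[j i] _.
transitivity (\sum_ji \sum_k cst (u ji) * ((p ji k).<[t]> * b k)).
  by apply: eq_bigr => ji _; rewrite (pP ji).2 mulr_sumr.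
rewrite exchange_big big1// => k _.
have -> : \sum_ji cst (u ji) * ((p ji k).<[t]> * b k) =
    (\sum_ji u ji *: p ji k).<[t]> * b k.
  by rewrite poly_at_sum mulr_suml; apply: eq_bigr => ji _; rewrite poly_atZ mulrA.
suff -> : \sum_ji u ji *: p ji k = 0 by rewrite poly_at0 mul0r.
apply/polyP => d; rewrite coef0 coef_sum.
have [dD|Dd] := ltnP d (D + C * J)%N.
  have := uA (k, Ordinal dD) => /= uA0; rewrite -[RHS]uA0.
  by apply: eq_bigr => ji _; rewrite coefZ.
rewrite big1// => ji _; rewrite coefZ nth_default ?mulr0//.
exact: leq_trans ((pP ji).1 k) Dd.
Qed.

(** Since K is algebraically closed, a polynomial vanishing at [f] splits, and one of its linear
    factors already vanishes there. *)
Lemma transcendental_or_cst f :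
  (forall p, p != 0 -> p.<[f]> != 0) \/ exists c, f = cst c.
Proof.
have [h|/existsNP[p /not_implyP[p0 /negP]]] :=
  pselect (forall p, p != 0 -> p.<[f]> != 0); first by left.
rewrite negbK => /eqP pf; right.
have [r pE] := closed_field_poly_normal p.
have : (\prod_(z <- r) (f - cst z)) = 0.
  apply/eqP; move/eqP: pf; rewrite pE poly_atZ mulf_eq0 fmorph_eq0 lead_coef_eq0.
  rewrite (negbTE p0)/= poly_at_prod.
  by under eq_bigr do rewrite poly_atB poly_at_X poly_atC.
move/eqP; rewrite prodf_seq_eq0 => /hasP[z _ /= /eqP fz].
by exists z; apply/eqP; rewrite -subr_eq0 fz.
Qed.

End FunctionField.

Section Relations.
Variables (K : closedFieldType) (X : curve K).
Local Notation F := (ratfun X).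
Local Notation cst := (kconst X).
Local Notation "p .<[ t ]>" := (poly_at cst p t) (at level 2, left associativity).
Implicit Types (f g h t : F) (P Q : {poly {poly K}}).

(* The value of a polynomial in K[T][Y] at T = t and Y = f. *)
Definition poly2_at t f P : F := (map_poly (map_poly cst) P).[f%:P].[t].

Lemma poly2_atD t f P Q : poly2_at t f (P + Q) = poly2_at t f P + poly2_at t f Q.
Proof. by rewrite /poly2_at rmorphD !hornerD. Qed.

Lemma poly2_atM t f P Q : poly2_at t f (P * Q) = poly2_at t f P * poly2_at t f Q.
Proof. by rewrite /poly2_at rmorphM !hornerM. Qed.

Lemma poly2_atC t f p : poly2_at t f p%:P = p.<[t]>.
Proof. by rewrite /poly2_at map_polyC hornerC. Qed.

Lemma poly2_at_X t f : poly2_at t f 'X = f.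
Proof. by rewrite /poly2_at map_polyX hornerX hornerC. Qed.

Lemma poly2_at0 t f : poly2_at t f 0 = 0.
Proof. by rewrite -polyC0 poly2_atC poly_at0. Qed.

Lemma poly2_at_horner t P (q : {poly K}) :
  (P.[q]).<[t]> = poly2_at t (q.<[t]>) P.
Proof.
elim/poly_ind: P => [|P p IH]; first by rewrite horner0 poly_at0 poly2_at0.
rewrite hornerMXaddC poly_atD poly_atM IH.
by rewrite poly2_atD poly2_atM poly2_at_X poly2_atC.
Qed.

Lemma poly2_at_poly t f n (c : nat -> {poly K}) :
  poly2_at t f (\poly_(i < n) c i) = \sum_(i < n) (c i).<[t]> * f ^+ i.
Proof.
rewrite poly_def.
rewrite (big_morph (poly2_at t f) (poly2_atD t f) (poly2_at0 t f)).
apply: eq_bigr => i _; rewrite -mul_polyC poly2_atM poly2_atC; congr (_ * _).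
by rewrite /poly2_at rmorphXn/= map_polyX hornerXn -rmorphXn/= hornerC.
Qed.

Lemma algebraic_relation t f : exists P, P != 0 /\ poly2_at t f P = 0.
Proof.
have [n /(_ (fun i => f ^+ i))[c [[i ci] cE]]] := poly_dependent t.
exists (\poly_(i < n.+1) c (inord i)); split.
  apply/eqP => /polyP/(_ i); rewrite coef_poly ltn_ord coef0 inord_val.
  by apply/eqP.
rewrite poly2_at_poly -[RHS]cE.
by apply: eq_bigr => j _; rewrite inord_val.
Qed.

(** A relation of least degree in Y works. Its derivative has smaller degree, so it cannot vanish at
    (t, f) unless it is zero; in characteristic 0 the relation would then be constant in Y and make
    [t] algebraic. Any derivation can thus be solved for the image of [f] in terms of that of
    [t]. *)
Lemma separable_relation t f : [pchar K] =i pred0 ->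
  (forall p, p != 0 -> p.<[t]> != 0) ->
  exists P, poly2_at t f P = 0 /\ poly2_at t f P^`() != 0.
Proof.
move=> K0 tP.
pose R n := `[< exists P, [/\ size P = n, P != 0 & poly2_at t f P = 0] >].
have h : exists n, R n.
  by have [P [P0 PE]] := algebraic_relation t f; exists (size P); apply/asboolP; exists P.
case: (ex_minnP h) => n /asboolP[P [Pn P0 PE]] nmin.
exists P; split=> //; apply/eqP => P'E.
have [P'0|P'0] := eqVneq P^`() 0; last first.
  suff /nmin : R (size P^`()).
    by rewrite leqNgt -Pn lt_size_deriv.
  by apply/asboolP; exists P^`().
have /size1_polyC PC : (size P <= 1)%N.
  rewrite leqNgt; apply/negP => P1.
  have : lead_coef P *+ (size P).-1 = 0.
    have /polyP/(_ (size P).-2) := P'0; rewrite coef_deriv coef0 lead_coefE.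
    by move: P1; case: (size P) => [|[|m]].
  apply/eqP; rewrite -mulr_natr -polyC_natr mulf_eq0 lead_coef_eq0 (negbTE P0)/=.
  move/pcharf0P: K0 => K0; rewrite polyC_eq0 K0.
  by move: P1; case: (size P) => [|[|m]].
move: PE; rewrite PC poly2_atC => /eqP; apply/negP/tP.
by apply: contra P0 => /eqP c0; rewrite PC c0 polyC0.
Qed.

(** [poly_dependent] bounds the length of families independent over K[h]; a family of maximal length
    spans up to denominators. *)
Lemma finite_span h : exists (n : nat) (y : 'I_n -> F), forall f,
  exists c, c != 0 /\ exists p : 'I_n -> {poly K},
    c.<[h]> * f = \sum_i (p i).<[h]> * y i.
Proof.
pose indep n := `[< exists v : 'I_n -> F,
  forall c : 'I_n -> {poly K}, \sum_i (c i).<[h]> * v i = 0 -> forall i, c i = 0 >].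
have [n0 n0P] := poly_dependent h.
have ex0 : exists n, indep n.
  by exists 0%N; apply/asboolP; exists (fun=> 0) => c _ [].
have bnd n : indep n -> (n <= n0)%N.
  move=> /asboolP[v vP]; rewrite leqNgt; apply/negP => n0n.
  have [c [[i ci] cE]] := n0P (fun i => v (widen_ord n0n i)).
  pose c' (j : 'I_n) := if insub (val j) is Some i then c i else 0.
  suff /vP/(_ (widen_ord n0n i)) : \sum_i (c' i).<[h]> * v i = 0.
    by rewrite /c' valK => /eqP; apply/negP.
  rewrite (bigID (fun j : 'I_n => (j < n0.+1)%N))/= [X in _ + X]big1 ?addr0.
    rewrite -[RHS]cE (big_ord_narrow n0n); apply: eq_bigr => j _.
    by rewrite /c' valK.
  by move=> j /negbTE jn; rewrite /c' insubF// poly_at0 mul0r.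
case: (ex_maxnP ex0 bnd) => n /asboolP[y yP] nmax.
exists n, y => f.
have /asboolPn/forallNP/(_ (fun i => oapp y f (unlift ord_max i))) :
    ~~ indep n.+1 by apply/negP => /nmax; rewrite ltnn.
move=> /existsNP[c /not_implyP[cE /existsNP[i /eqP ci]]].
move: cE; rewrite big_ord_recr/= unlift_none/=.
have wE j : widen_ord (leqnSn n) j = lift ord_max j.
  by apply: val_inj; rewrite /= /bump leqNgt ltn_ord.
under eq_bigr => j _ do rewrite wE liftK/=.
move=> cE; exists (c ord_max); split; last first.
  exists (fun j => - c (lift ord_max j)).
  move/eqP: cE; rewrite addrC addr_eq0 => /eqP ->; rewrite -sumrN.
  by apply: eq_bigr => j _; rewrite poly_atN mulNr.
apply: contra ci => /eqP c0; move: cE; rewrite c0 poly_at0 mul0r addr0 => /yP cE.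
case: (unliftP ord_max i) => [j ->|->]; last by apply/eqP.
by apply/eqP; exact: cE.
Qed.

Lemma regular_poly_at (x : closed_point X) p f : regular x f -> regular x p.<[f]>.
Proof.
move=> fx; elim/poly_ind: p => [|p c IH]; first by rewrite poly_at0; left.
rewrite poly_atD poly_atM poly_at_X poly_atC.
by apply: regularD; [exact: regularM|exact: ordp_ge_cst].
Qed.

(** If no f - c vanished at [x], every nonzero polynomial in [f] would be a unit at [x], since it
    splits into linear factors. The powers of a uniformizer would then be independent over K[f],
    against [poly_dependent]. *)
Lemma residue_field (x : closed_point X) f : regular x f ->
  exists c, ordp_ge x 1 (f - cst c).
Proof.
move=> fx; apply: contrapT => /forallNP noc.
have fc c : f - cst c != 0 /\ x (f - cst c) = 0.
  have f0 : f - cst c != 0 by apply/eqP => fE; apply: (noc c); left.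
  split=> //; apply: le_anti; apply/andP; split.
    by rewrite leNgt; apply/negP => f1; apply: (noc c); right.
  apply/(ordp_geE _ _ f0).
  by apply: ordp_geB => //; exact: ordp_ge_cst.
have pf p : p != 0 -> p.<[f]> != 0 /\ x (p.<[f]>) = 0.
  move=> p0; have [r ->] := closed_field_poly_normal p.
  elim: r => [|z r [IH0 IH1]].
    rewrite big_nil poly_atZ poly_at1 mulr1 ordpC fmorph_eq0 lead_coef_eq0.
    by split.
  have [fz0 fz1] := fc z.
  rewrite big_cons scalerAr poly_atM poly_atB poly_at_X poly_atC mulf_neq0//.
  by rewrite ordpM// fz1 IH1.
pose t := uniformizer x.
have [n /(_ (fun i => t ^+ i))[c [[i ci] cE]]] := poly_dependent f.
(* With [j] least among the indices of nonzero coefficients, the j-th term has order exactly j and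
   all others have larger order. *)
case: (@arg_minnP _ i (fun j => c j != 0) (fun j => j : nat) ci) => j cj jmin.
have [cj0 cj1] := pf _ cj.
have t0 : t ^+ j != 0 by rewrite expf_neq0// uniformizer_neq0.
have : ordp_ge x (j%:Z + 1) ((c j).<[f]> * t ^+ j).
  move: cE; rewrite (bigD1 j)//= => /eqP; rewrite addr_eq0 => /eqP ->.
  apply: ordp_geN; apply: ordp_ge_sum => k kj.
  have [ck|ck] := eqVneq (c k) 0; first by rewrite ck poly_at0 mul0r; left.
  have jk : (j < k)%N by rewrite ltn_neqAle eq_sym kj jmin.
  rewrite -[_ + 1]add0r; apply: ordp_geM; first exact: regular_poly_at.
  right; rewrite ordpX ordp_uniformizer -mulr_natr mul1r natz; lia.
move=> /ordp_geE; rewrite mulf_neq0// => /(_ erefl).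
by rewrite ordpM// cj1 ordpX ordp_uniformizer -mulr_natr mul1r add0r natz; lia.
Qed.

End Relations.

(** * Local expansions *)

Section Expansions.
Variables (K : closedFieldType) (X : curve K) (x : closed_point X).
Local Notation F := (ratfun X).
Local Notation cst := (kconst X).
Local Notation t := (uniformizer x).
Local Notation ge := (ordp_ge x).
Local Notation coef := (expansion x).
Implicit Types (f g : F) (m n : int) (a b : int -> K) (N : nat).

Let subrBB f g h : f - g - (f - h) = h - g. Proof. by ring. Qed.

Let subrBK f g h : f - h - (g - h) = f - g. Proof. by ring. Qed.

Let partial m a N := \sum_(k < N) cst (a (m + k%:Z)) * t ^ (m + k%:Z).

(** [is_expansion] with its starting degree made explicit, so that two expansions can be compared
    from a common start. *)
Let expands m f a :=
  (forall n, n < m -> a n = 0) /\ forall N, ge (m + N%:Z) (f - partial m a N).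

Lemma leading_coef n f : ge n f -> exists c, ge (n + 1) (f - cst c * t ^ n).
Proof.
move=> fn; have t0 := uniformizerXz_neq0 x n.
have /residue_field[c fc] : regular x (f * t ^ (- n)).
  rewrite /regular -(addrN n); apply: ordp_geM fn _.
  exact: ordp_ge_uniformizerXz.
exists c; have := ordp_geM fc (ordp_ge_uniformizerXz x n).
by rewrite mulrBl -mulrA -expfzDr ?uniformizer_neq0// addNr expr0z mulr1 addrC.
Qed.

Let expands_exists m f : ge m f -> exists a, expands m f a.
Proof.
move=> fm.
have /choice[lc lcP] (ng : int * F) : exists c, ge ng.1 ng.2 ->
    ge (ng.1 + 1) (ng.2 - cst c * t ^ ng.1).
  have [/leading_coef[c gc]|gn] := pselect (ge ng.1 ng.2); first by exists c.
  by exists 0 => /gn.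
(* [r k] is the remainder after k leading terms have been subtracted; the coefficients are read off
   these remainders. *)
pose r := fix r N := if N is k.+1 then
  r k - cst (lc (m + k%:Z, r k)) * t ^ (m + k%:Z) else f.
pose a n := if n < m then 0 else lc (n, r `|n - m|%N).
have aE k : a (m + k%:Z) = lc (m + k%:Z, r k).
  by rewrite /a ifF; [congr (lc (_, r _)); lia|lia].
exists a; split=> [n nm|N]; first by rewrite /a nm.
have -> : f - partial m a N = r N.
  elim: N => [|N IHN]; first by rewrite /partial big_ord0 subr0.
  by rewrite /partial big_ord_recr/= opprD addrA IHN aE.
elim: N => [|N IHN]; first by rewrite addr0.
have -> : m + N.+1%:Z = m + N%:Z + 1 by lia.
exact: (lcP (_, _) IHN).
Qed.

Let expands_le m m' f a : m' <= m -> expands m f a -> expands m' f a.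
Proof.
move=> mm [a0 fa]; split=> [n nm|N]; first by apply: a0; exact: lt_le_trans mm.
have [Nm|mN] := leqP N `|m - m'|.
  rewrite /partial big1 => [|k _]; last by rewrite a0 ?rmorph0 ?mul0r//; have := ltn_ord k; lia.
  by have := fa 0%N; rewrite /partial big_ord0; apply: ordp_geW; lia.
have [M ->] : exists M, N = (`|m - m'| + M)%N.
  by exists (N - `|m - m'|)%N; rewrite subnKC// ltnW.
have := fa M; have -> : partial m' a (`|m - m'| + M)%N = partial m a M.
  rewrite /partial big_split_ord/= big1 ?add0r => [|k _].
    by apply: eq_bigr => k _; have -> : m' + (`|m - m'| + k)%:Z = m + k%:Z by lia.
  by rewrite a0 ?rmorph0 ?mul0r//; have := ltn_ord k; lia.
by apply: ordp_geW; lia.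
Qed.

Let expands_uniq m f a b : expands m f a -> expands m f b -> a = b.
Proof.
move=> [a0 fa] [b0 fb]; apply/funext => n.
have [nm|mn] := ltP n m; first by rewrite a0 ?b0.
have -> : n = m + `|n - m|%:Z by lia.
elim/ltn_ind: `|n - m|%N => k IHk.
have := ordp_geB (fb k.+1) (fa k.+1); rewrite subrBB /partial -sumrB big_ord_recr/= big1 ?add0r => [|j _].
  rewrite -mulrBl -rmorphB; have -> : m + k.+1%:Z = m + k%:Z + 1 by lia.
  move=> /ordp_geM/(_ (ordp_ge_uniformizerXz x (- (m + k%:Z)))).
  rewrite -mulrA -expfzDr ?uniformizer_neq0// addrN expr0z mulr1 addrAC addrN add0r.
  by move=> /cst_ordp_ge1/eqP; rewrite subr_eq0 => /eqP.
by rewrite IHk// subrr.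
Qed.

Let is_expansion_uniq f a b : is_expansion x f a -> is_expansion x f b -> a = b.
Proof.
move=> [m fa] [m' fb]; apply: (@expands_uniq (Num.min m m') f).
  by apply: expands_le fa; rewrite ge_min lexx.
by apply: expands_le fb; rewrite ge_min lexx orbT.
Qed.

Lemma expansion_eq f a : is_expansion x f a -> coef f = a.
Proof.
move=> fa; apply: is_expansion_uniq (fa).
exact: (@xgetPex _ (fun=> 0) [set b | is_expansion x f b] (ex_intro _ a fa)).
Qed.

Let coefP m f : ge m f -> expands m f (coef f).
Proof.
by move=> /expands_exists[a fa]; rewrite (@expansion_eq f a)//; exists m.
Qed.

Lemma expansion_lt m f n : ge m f -> n < m -> coef f n = 0.
Proof. by move=> /coefP[+ _]; apply. Qed.

Lemma expansion_ge m f : (forall n, n < m -> coef f n = 0) -> ge m f.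
Proof.
move=> fm; have [mf|fm'] := leP m (x f).
  exact: ordp_geW mf (ordp_ge_ordp x f).
have [_ /(_ `|m - x f|%N)] := coefP (ordp_ge_ordp x f).
rewrite /partial big1 => [|k _]; first by rewrite subr0; apply: ordp_geW; lia.
by rewrite fm ?rmorph0 ?mul0r//; have := ltn_ord k; lia.
Qed.

Lemma expansion_inj f g : coef f = coef g -> f = g.
Proof.
have common h : ge (Num.min (x f) (x g)) h -> expands (Num.min (x f) (x g)) h (coef h).
  exact: coefP.
have gef : ge (Num.min (x f) (x g)) f.
  by apply: ordp_geW (ordp_ge_ordp x f); rewrite ge_min lexx.
have geg : ge (Num.min (x f) (x g)) g.
  by apply: ordp_geW (ordp_ge_ordp x g); rewrite ge_min lexx orbT.
move=> fg; apply/eqP; rewrite -subr_eq0; apply/eqP/(@ordp_ge_eq0 _ _ x) => n.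
have [_ /(_ `|n - Num.min (x f) (x g)|%N) fE] := common _ gef.
have [_ /(_ `|n - Num.min (x f) (x g)|%N) gE] := common _ geg.
by have := ordp_geB fE gE; rewrite fg subrBK; apply: ordp_geW; lia.
Qed.

Lemma expansionD f g n : coef (f + g) n = coef f n + coef g n.
Proof.
pose m := Num.min (x f) (x g).
have [f0 fE] : expands m f (coef f).
  by apply: expands_le (coefP (ordp_ge_ordp x f)); rewrite ge_min lexx.
have [g0 gE] : expands m g (coef g).
  by apply: expands_le (coefP (ordp_ge_ordp x g)); rewrite ge_min lexx orbT.
have /expansion_eq -> // : is_expansion x (f + g) (fun n => coef f n + coef g n).
exists m; split=> [k km|N]; first by rewrite f0// g0// addr0.
have := ordp_geD (fE N) (gE N).
rewrite addrACA -opprD /partial -big_split/=.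
by under eq_bigr do rewrite -mulrDl -rmorphD.
Qed.

Lemma expansionZ c f n : coef (cst c * f) n = c * coef f n.
Proof.
have [f0 fE] := coefP (ordp_ge_ordp x f).
have /expansion_eq -> // : is_expansion x (cst c * f) (fun n => c * coef f n).
exists (x f); split=> [k km|N]; first by rewrite f0// mulr0.
have := ordp_geCl c (fE N); rewrite mulrBr mulr_sumr.
by under eq_bigr do rewrite mulrA -rmorphM.
Qed.

Lemma expansion0 n : coef 0 n = 0.
Proof. by rewrite -(mul0r 0) -(rmorph0 cst) expansionZ mul0r. Qed.

Lemma expansionN f n : coef (- f) n = - coef f n.
Proof. by rewrite -mulN1r -(rmorph1 cst) -rmorphN expansionZ mulN1r. Qed.

Lemma expansionB f g n : coef (f - g) n = coef f n - coef g n.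
Proof. by rewrite expansionD expansionN. Qed.

Lemma expansion_sum (I : Type) (r : seq I) (P : pred I) (f : I -> F) n :
  coef (\sum_(i <- r | P i) f i) n = \sum_(i <- r | P i) coef (f i) n.
Proof.
exact: (big_morph (fun f => coef f n) (fun f g => expansionD f g n) (expansion0 n)).
Qed.

Lemma expansion_shift m f n : coef (t ^ m * f) n = coef f (n - m).
Proof.
have [f0 fE] := coefP (ordp_ge_ordp x f).
have /expansion_eq -> // : is_expansion x (t ^ m * f) (fun n => coef f (n - m)).
exists (m + x f); split=> [k km|N]; first by rewrite f0//; lia.
have := ordp_geM (ordp_ge_uniformizerXz x m) (fE N).
rewrite mulrBr mulr_sumr addrA.
under eq_bigr => k _ do rewrite mulrCA -expfzDr ?uniformizer_neq0//.
congr (ge _ (_ - _)); apply: eq_bigr => k _.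
by rewrite (_ : m + x f + k%:Z - m = x f + k%:Z) ?addrA//; lia.
Qed.

Lemma expansion1 n : coef 1 n = (n == 0)%:R.
Proof.
have /expansion_eq -> // : is_expansion x 1 (fun n => (n == 0)%:R).
exists 0; split=> [k k0|[|N]]; first by rewrite lt_eqF.
  by rewrite big_ord0 (subr0 (1 : F)); exact: ordp_ge1.
rewrite big_ord_recl/= big1 => [|k _].
  by rewrite rmorph1 expr0z mulr1 addr0 subrr; left.
by rewrite rmorph0 mul0r.
Qed.

Lemma expansionXz m n : coef (t ^ m) n = (n == m)%:R.
Proof. by rewrite -[t ^ m]mulr1 expansion_shift expansion1 subr_eq0. Qed.

(** The tail of [f] after N terms, multiplied by [g], has order at least m + N + m' and cannot reach
    degree [n]. The free cutoff N lets several products be compared over the same range. *)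
Lemma expansionM m m' N f g n : ge m f -> ge m' g -> n < m + N%:Z + m' ->
  coef (f * g) n = \sum_(k < N) coef f (m + k%:Z) * coef g (n - (m + k%:Z)).
Proof.
move=> fm gm nN; have [f0 /(_ N) fE] := coefP fm.
rewrite -[f in LHS](subrK (partial m (coef f) N)) mulrDl expansionD.
rewrite (expansion_lt (ordp_geM fE gm) nN) add0r mulr_suml expansion_sum.
by apply: eq_bigr => k _; rewrite -mulrA expansionZ expansion_shift.
Qed.

Lemma expansion_poly (p : {poly K}) n :
  coef (poly_at cst p t) n = if n is Posz k then p`_k else 0.
Proof.
rewrite poly_at_coef expansion_sum.
under eq_bigr => j _ do rewrite expansionZ exprnP expansionXz.
case: n => k; last by rewrite big1// => j _; rewrite mulr0.
have [kp|pk] := ltnP k (size p); last first.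
  rewrite nth_default// big1// => j _.
  by rewrite eqz_nat gtn_eqF ?mulr0// (leq_trans _ pk).
rewrite (bigD1 (Ordinal kp))//= eqxx mulr1 big1 ?addr0// => j.
by rewrite -val_eqE/= eqz_nat eq_sym => /negbTE ->; rewrite mulr0.
Qed.

Lemma truncation m f : ge m f -> forall N,
  ge (m + N%:Z) (f - \sum_(k < N) cst (coef f (m + k%:Z)) * t ^ (m + k%:Z)).
Proof. by move=> /coefP[]. Qed.

End Expansions.

(** * Derivatives and forms *)

Section Derivations.
Variables (K : closedFieldType) (X : curve K).
Hypothesis K_char0 : [pchar K] =i pred0.
Local Notation F := (ratfun X).
Local Notation cst := (kconst X).
Local Notation "p .<[ t ]>" := (poly_at cst p t) (at level 2, left associativity).
Implicit Types (x : closed_point X) (f g h : F) (w : meroform X).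

Lemma intr_eq0_pchar0 (n : int) : (n%:~R == 0 :> K) = (n == 0).
Proof.
move/pcharf0P: K_char0 => K0; case: n => k; first by rewrite -pmulrn K0.
by rewrite NegzE mulrNz oppr_eq0 -pmulrn K0 oppr_eq0.
Qed.

Lemma uniformizer_transcendental x p : p != 0 -> p.<[uniformizer x]> != 0.
Proof.
case: (transcendental_or_cst (uniformizer x)) => [|[c tc]]; first by apply.
by have := ordp_uniformizer x; rewrite tc ordpC.
Qed.

Lemma derivation_poly_at (M : lmodType F) (D : F -> M) t p :
  derivation_over cst D -> D p.<[t]> = (p^`()).<[t]> *: D t.
Proof.
move=> [DD DM DC]; elim/poly_ind: p => [|p c IH].
  by rewrite deriv0 poly_at0 scale0r -(rmorph0 cst) DC.
rewrite poly_atD poly_atM poly_at_X poly_atC DD DM DC addr0 IH.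
rewrite derivD derivM derivX derivC addr0 mulr1 poly_atD poly_atM poly_at_X.
by rewrite scalerDl scalerA mulrC addrC.
Qed.

(** [PT] is the partial derivative in the coefficient variable T. The first chain rule applies to
    the truncations of an expansion, the second to derivations of the function field; both must hold
    for the same [PT]. *)
Lemma first_partial_derivative (P : {poly {poly K}}) : exists PT,
  (forall q, (P.[q])^`() = PT.[q] + P^`().[q] * q^`()) /\
  forall (M : lmodType F) (D : F -> M), derivation_over cst D -> forall t f,
    D (poly2_at t f P) = poly2_at t f PT *: D t + poly2_at t f P^`() *: D f.
Proof.
elim/poly_ind: P => [|P p [PT [Pq PD]]].
  exists 0; split=> [q|M D [_ _ DC] t f].
    by rewrite deriv0 !horner0 deriv0 mul0r addr0.
  by rewrite deriv0 poly2_at0 -(rmorph0 cst) DC rmorph0 !scale0r addr0.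
exists (PT * 'X + p^`()%:P); split=> [q|M D DP t f].
  rewrite !hornerMXaddC derivD derivM Pq derivD derivM derivX derivC addr0 mulr1.
  by rewrite hornerD hornerMX; ring.
have [DD DM DC] := DP.
rewrite !(poly2_atD, poly2_atM, poly2_at_X, poly2_atC) DD DM (PD _ _ DP).
rewrite (derivation_poly_at _ _ DP) derivD derivM derivX derivC addr0 mulr1.
rewrite poly2_atD poly2_atM poly2_at_X !scalerDl !scalerDr !scalerA ![_ * f]mulrC.
by rewrite !addrA [LHS](ACl (2*4*3*1))/=.
Qed.

(** The difference of the two values is f - g times a function regular at [x]. *)
Lemma poly2_at_continuous x t (n : nat) f g (P : {poly {poly K}}) :
  regular x t -> regular x f -> regular x g -> ordp_ge x n (f - g) ->
  ordp_ge x n (poly2_at t f P - poly2_at t g P).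
Proof.
move=> tx fx gx fg.
have Px h (Q : {poly {poly K}}) : regular x h -> regular x (poly2_at t h Q).
  move=> hx; elim/poly_ind: Q => [|Q q IH]; first by rewrite poly2_at0; left.
  rewrite poly2_atD poly2_atM poly2_at_X poly2_atC.
  by apply: regularD; [exact: regularM|exact: regular_poly_at].
elim/poly_ind: P => [|P p IH]; first by rewrite !poly2_at0 subrr; left.
rewrite !poly2_atD !poly2_atM !poly2_at_X !poly2_atC.
rewrite (_ : _ - _ = (poly2_at t f P - poly2_at t g P) * f +
  poly2_at t g P * (f - g)); last by ring.
apply: ordp_geD; first by rewrite -[n%:Z]addr0; exact: ordp_geM.
by rewrite -[n%:Z]add0r; apply: ordp_geM => //; exact: Px.
Qed.

Let der_coef x f (n : int) : K := (n + 1)%:~R * expansion x f (n + 1).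

(* With P(t, f) = 0, the truncations f_N of f satisfy
   P_T(t, f_N) + P_Y(t, f_N) f_N' = 0 up to order N - 1, so that f_N' converges
   to the element - P_T(t, f) / P_Y(t, f) of the function field. *)
Lemma regular_derivative_exists x f : regular x f ->
  exists z, forall n, expansion x z n = der_coef x f n.
Proof.
set t := uniformizer x => fx.
have [P [PE P'0]] := separable_relation f K_char0 (@uniformizer_transcendental x).
have [PT [Pq _]] := first_partial_derivative P.
set e := poly2_at _ _ _ in P'0.
pose G (N : nat) := \poly_(k < N) expansion x f k%:Z.
have tx : regular x t by right; rewrite ordp_uniformizer.
have Gx (p : {poly K}) : regular x p.<[t]> by exact: regular_poly_at.
have fG N : ordp_ge x N%:Z ((G N).<[t]> - f).
  have := truncation fx N; rewrite add0r => fN.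
  rewrite -opprB; apply: ordp_geN.
  by rewrite poly_at_poly; under eq_bigr do rewrite exprnP -[_%:Z]add0r.
pose z := - poly2_at t f PT / e; exists z => n.
(* One order is lost by differentiating the truncation, and [x e] more by dividing by [e] = P_Y(t,
   f). *)
have zG N : ordp_ge x (N%:Z - 1 - x e) (z - ((G N)^`()).<[t]>).
  have pN : ordp_ge x (N%:Z - 1) ((P.[G N])^`()).<[t]>.
    have pN0 : ordp_ge x N%:Z (P.[G N]).<[t]>.
      rewrite poly2_at_horner -[poly2_at _ _ _]subr0 -PE.
      exact: poly2_at_continuous.
    apply: (expansion_ge (x := x)) => k kN; rewrite expansion_poly.
    case: k kN => // k kN; rewrite coef_deriv.
    have := expansion_lt (n := k.+1%:Z) pN0; rewrite expansion_poly => -> //.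
      by rewrite mul0rn.
    by lia.
  have : ordp_ge x (N%:Z - 1) (e * (z - ((G N)^`()).<[t]>)).
    have -> : e * (z - ((G N)^`()).<[t]>) =
        (poly2_at t (G N).<[t]> PT - poly2_at t f PT) +
        (poly2_at t (G N).<[t]> P^`() - e) * ((G N)^`()).<[t]> -
        ((P.[G N])^`()).<[t]>.
      by rewrite Pq poly_atD poly_atM !poly2_at_horner /z; field.
    have N1 : N%:Z - 1 <= N%:Z by lia.
    apply: ordp_geB => //; apply: (ordp_geW N1); apply: ordp_geD.
      exact: poly2_at_continuous.
    rewrite -[N%:Z]addr0; apply: ordp_geM; last exact: Gx.
    exact: poly2_at_continuous.
  move=> /ordp_geM -/(_ _ _ (ordp_ge_ordp x e^-1)).
  by rewrite mulrAC divff// mul1r ordpV.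
(* Large enough for degree n to lie below the error bound N - 1 - x e, and for the truncation to
   contain the coefficient of degree n + 1. *)
pose N := (`|(n + 1)%R| + 2 + `|x e|)%N.
have := zG N => /expansion_lt => /(_ n); rewrite expansionB => zn.
have /eqP : expansion x z n - expansion x ((G N)^`()).<[t]> n = 0.
  by apply: zn; lia.
rewrite subr_eq0 => /eqP ->; rewrite expansion_poly /der_coef.
case: n @N zn => k /= zn.
  rewrite coef_deriv coef_poly ifT; last by lia.
  rewrite -mulr_natl -pmulrn; congr (_%:R * expansion x f _); lia.
case: k zn => [|k] zn; first by rewrite (_ : Negz 0 + 1 = 0)// mul0r.
by rewrite (expansion_lt fx) ?mulr0//; lia.
Qed.

Lemma derivative_exists x f :
  exists z, forall n, expansion x z n = der_coef x f n.
Proof.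
set t := uniformizer x; pose m := `|x f|%N.
have /regular_derivative_exists[z zE] : regular x (t ^ m * f).
  apply: (@ordp_geW _ _ _ (m%:Z + x f)); first by lia.
  by apply: ordp_geM; [exact: ordp_ge_uniformizerXz|exact: ordp_ge_ordp].
(* Reduction to the regular case by f' = t^(-m) (t^m f)' - m t^(-1) f. *)
exists (t ^ (- m%:Z) * z - cst m%:R * (t ^ (- 1) * f)) => n.
rewrite expansionB expansion_shift zE expansionZ expansion_shift.
rewrite /der_coef expansion_shift !opprK.
rewrite (_ : n + m%:Z + 1 - m%:Z = n + 1); last by lia.
by rewrite -mulrBl pmulrn -mulrzBr; congr (_%:~R * _); lia.
Qed.

Definition derivative x f : F := xget 0 [set z | forall n, expansion x z n = der_coef x f n].

Lemma derivativeE x f n :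
  expansion x (derivative x f) n = (n + 1)%:~R * expansion x f (n + 1).
Proof. exact: (xgetPex 0 (derivative_exists x f)). Qed.

Lemma ordp_ge_derivative x f (n : int) :
  ordp_ge x n f -> ordp_ge x (n - 1) (derivative x f).
Proof.
move=> fn; apply: expansion_ge => k kn.
by rewrite derivativeE (expansion_lt fn) ?mulr0//; lia.
Qed.

Lemma derivative_derivation x :
  derivation_over cst (derivative x : F -> F^o).
Proof.
split=> [f g|f g|c]; apply: (@expansion_inj _ _ x); apply/funext => n.
- by rewrite expansionD !derivativeE expansionD mulrDr.
- pose N := absz (n + 1 - x f - x g + 1)%R.
  have fx := ordp_ge_ordp x f; have gx := ordp_ge_ordp x g.
  rewrite expansionD derivativeE (expansionM fx gx (N := N)); last by lia.
  rewrite (expansionM fx (ordp_ge_derivative gx) (N := N)); last by lia.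
  rewrite [g *: _]mulrC (expansionM (ordp_ge_derivative fx) gx (N := N)); last by lia.
  rewrite mulr_sumr -big_split; apply: eq_bigr => k _ /=; rewrite !derivativeE.
  rewrite (_ : n - (x f + k%:Z) + 1 = n + 1 - (x f + k%:Z)); last by lia.
  rewrite (_ : x f - 1 + k%:Z + 1 = x f + k%:Z); last by lia.
  rewrite (_ : n - (x f - 1 + k%:Z) = n + 1 - (x f + k%:Z)); last by lia.
  (* The Leibniz rule coefficientwise: the factor n + 1 is the sum of the degrees of the two
     coefficients multiplied. *)
  rewrite -{1}(subrK (x f + k%:Z) (n + 1)) intrD; ring.
- rewrite derivativeE -[cst c]mulr1 expansionZ expansion1 expansion0.
  by have [->|_] := eqVneq (n + 1) 0; rewrite ?mul0r ?mulr0.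
Qed.

Lemma derivative_uniformizer x : derivative x (uniformizer x) = 1.
Proof.
apply: (@expansion_inj _ _ x); apply/funext => n.
rewrite derivativeE -[X in expansion x X]expr1z expansionXz expansion1.
rewrite -subr_eq0 addrK; have [->|_] := eqVneq n 0; first by rewrite mulr1.
by rewrite mulr0.
Qed.

Local Notation dt x := (df (uniformizer x) : meroform X).

(** The quotient w / dt, spelled exactly as inside [form_expansion], so that [residueE] holds by
    conversion. *)
Definition form_coef x w : F := xget 0 [set h | w = h *: dt x].

(** The forms are free of rank one on dt. The universal property turns [derivative] into a linear
    [phi] with phi(dt) = 1; a separable relation P(t, f) = 0, differentiated, puts df in F dt, and
    [phi] identifies the factor. *)
Let coef_linear x : exists phi : {linear meroform X -> F^o},
  forall w h, w = h *: dt x <-> h = phi w.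
Proof.
have [dP univ] := formP X.
have [phi [phiE _]] := univ _ _ (derivative_derivation x).
have phit : phi (dt x) = 1 by rewrite -[RHS](derivative_uniformizer x) phiE.
have dfE f : df f = derivative x f *: dt x.
  have [P [PE P'0]] := separable_relation f K_char0 (@uniformizer_transcendental x).
  have [PT [_ PD]] := first_partial_derivative P.
  have := PD _ _ dP (uniformizer x) f.
  rewrite PE -(rmorph0 cst) dfC => /esym/eqP; rewrite addrC addr_eq0 => /eqP dE.
  have {}dE : df f = (- (poly2_at (uniformizer x) f P^`())^-1 *
      poly2_at (uniformizer x) f PT) *: dt x.
    by rewrite mulNr scaleNr -scalerA -scalerN -dE scalerA mulVf// scale1r.
  rewrite {1}dE (_ : derivative x f = phi (df f)) ?phiE//.
  by rewrite dE linearZ/= phit [_ *: 1]mulr1.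
have phiw w : w = phi w *: dt x.
  have [psi [psiE psiU]] := univ _ _ dP.
  (* [chi] and the identity agree on exact forms, hence everywhere by the uniqueness in the
     universal property. *)
  pose chi w : meroform X := (phi w : F) *: dt x.
  have chil : linear chi.
    by move=> a u v; rewrite /chi linearP scalerDl scalerA.
  pose chiL : {linear meroform X -> meroform X} := HB.pack chi
    (GRing.isLinear.Build _ _ _ _ chi chil).
  have -> : phi w *: dt x = chiL w by [].
  rewrite (psiU chiL) => [|f].
    by rewrite -(psiU idfun).
  by rewrite /= /chi [LHS]dfE; congr (_ *: _); exact: phiE.
exists phi => w h; split=> [->|->//].
by rewrite linearZ/= phit [_ *: 1]mulr1.
Qed.

Lemma form_coefP x w h : w = h *: dt x <-> h = form_coef x w.
Proof.
have [phi phiP] := coef_linear x; have phiw h' := phiP w h'.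
suff -> : form_coef x w = phi w by [].
apply/phiw; apply: (@xgetPex _ 0 [set h | w = h *: dt x]).
by exists (phi w); apply/phiw.
Qed.

Lemma form_coefE x w : form_coef x w *: dt x = w.
Proof. by apply/esym/form_coefP. Qed.

Lemma form_coefD x w w' : form_coef x (w + w') = form_coef x w + form_coef x w'.
Proof. by apply/esym/form_coefP; rewrite scalerDl !form_coefE. Qed.

Lemma form_coefZ x f w : form_coef x (f *: w) = f * form_coef x w.
Proof. by apply/esym/form_coefP; rewrite -scalerA form_coefE. Qed.

Lemma form_coefN x w : form_coef x (- w) = - form_coef x w.
Proof. by rewrite -scaleN1r form_coefZ mulN1r. Qed.

Lemma form_coef0 x : form_coef x 0 = 0.
Proof. by rewrite -(scale0r 0) form_coefZ mul0r. Qed.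

Lemma form_coef_df x f : form_coef x (df f) = derivative x f.
Proof.
have [phi phiP] := coef_linear x.
have [dP univ] := formP X.
have [psi [psiE _]] := univ _ _ (derivative_derivation x).
have psit : psi (dt x) = 1 by rewrite -[RHS](derivative_uniformizer x) psiE.
have -> : derivative x f = psi (df f) by exact: psiE.
by rewrite -{2}(form_coefE x (df f)) linearZ/= psit [_ *: 1]mulr1.
Qed.

(** The regular forms at [x] are O dt: differentiating a series without polar part produces none,
    because the coefficient in degree -1 carries the factor 0. *)
Lemma form_regularP x w : form_regular x w <-> regular x (form_coef x w).
Proof.
split=> [[n [f [g [fg ->]]]]|wx].
  rewrite (big_morph (form_coef x) (form_coefD x) (form_coef0 x)).
  apply: ordp_ge_sum => k _; have [fx gx] := fg k.
  rewrite form_coefZ form_coef_df -[0]addr0; apply: ordp_geM => //.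
  apply: expansion_ge => m m0; rewrite derivativeE.
  have [->|m1] := eqVneq m (-1); first by rewrite addNr mul0r.
  by rewrite (expansion_lt gx) ?mulr0//; lia.
exists 1%N, (fun=> form_coef x w), (fun=> uniformizer x); split=> [_|].
  by split=> //; right; rewrite ordp_uniformizer.
by rewrite big_ord1 form_coefE.
Qed.

Lemma form_regular_df x f : regular x f -> form_regular x (df f).
Proof.
move=> fx; exists 1%N, (fun=> 1), (fun=> f); split; last by rewrite big_ord1 scale1r.
by move=> _; split=> //; exact: ordp_ge1.
Qed.

Lemma residueE x w : residue x w = expansion x (form_coef x w) (-1).
Proof. by []. Qed.

Lemma residueD x w w' : residue x (w + w') = residue x w + residue x w'.
Proof. by rewrite !residueE form_coefD expansionD. Qed.

Lemma residueN x w : residue x (- w) = - residue x w.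
Proof. by rewrite !residueE form_coefN expansionN. Qed.

Lemma residueB x w w' : residue x (w - w') = residue x w - residue x w'.
Proof. by rewrite residueD residueN. Qed.

Lemma residue_regular x w : form_regular x w -> residue x w = 0.
Proof. by move=> /form_regularP wx; rewrite residueE (expansion_lt wx). Qed.

Lemma residue_df x f : residue x (df f) = 0.
Proof. by rewrite residueE form_coef_df derivativeE addNr mul0r. Qed.

(** Only the polar part is integrated: its primitive is a Laurent polynomial in the uniformizer,
    hence an element of the function field, which the full primitive need not be. *)
Lemma local_primitive x w : residue x w = 0 -> exists f, form_regular x (df f - w).
Proof.
rewrite residueE; set h := form_coef x w => h1.
pose m := `|x h|%N.
have hm : ordp_ge x (- m%:Z) h by apply: ordp_geW (ordp_ge_ordp x h); lia.
pose a (j : int) := expansion x h (j - 1) / j%:~R.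
exists (\sum_(k < m) cst (a (1 - m%:Z + k%:Z)) * uniformizer x ^ (1 - m%:Z + k%:Z)).
apply/form_regularP; rewrite form_coefD form_coefN form_coef_df.
apply: expansion_ge => n n0; rewrite expansionB derivativeE expansion_sum.
under eq_bigr do rewrite expansionZ expansionXz.
rewrite -/h; have [nm|mn] := ltP n (- m%:Z).
  rewrite (expansion_lt hm nm) subr0 big1 => [|k _]; first by rewrite mulr0.
  by rewrite (_ : (_ == _) = false) ?mulr0n ?mulr0//; lia.
have km : (absz (n + m%:Z)%R < m)%N by lia.
rewrite (bigD1 (Ordinal km))//= big1 ?addr0 => [|k]; last first.
  rewrite -val_eqE/= => kn; rewrite (_ : (_ == _) = false) ?mulr0n ?mulr0//; lia.
rewrite (_ : 1 - m%:Z + (absz (n + m%:Z)%R)%:Z = n + 1); last by lia.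
rewrite eqxx mulr1 /a addrK.
have [->|n1] := eqVneq n (-1); first by rewrite h1 addNr mul0r subrr.
by rewrite mulrC divfK ?subrr// intr_eq0_pchar0; lia.
Qed.

End Derivations.

(** * Weak approximation and finiteness of poles *)

Lemma leq_bigmax_mem (I : eqType) (r : seq I) (F : I -> nat) (i : I) :
  i \in r -> (F i <= \max_(j <- r) F j)%N.
Proof. by move=> ir; exact: leq_bigmax_seq. Qed.

Lemma infinite_uniq_seq (T : choiceType) (A : set T) (n : nat) :
  infinite_set A -> exists l : seq T, [/\ uniq l, size l = n & forall x, x \in l -> A x].
Proof.
move=> /(infinite_set_fset n)[B BA nB].
exists (take n (finmap.enum_fset B)); split.
- by rewrite take_uniq// finmap.fset_uniq.
- by rewrite size_takel.
- by move=> x /mem_take xB; apply: BA.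
Qed.

Section Approximation.
Variables (K : closedFieldType) (X : curve K).
Local Notation F := (ratfun X).
Local Notation cst := (kconst X).
Local Notation "p .<[ t ]>" := (poly_at cst p t) (at level 2, left associativity).
Implicit Types (x y : closed_point X) (f g h : F).

Lemma closed_point_eq x y : (forall f, x f = y f) -> x = y.
Proof.
case: x => o p1 p2 p3 p4 p5; case: y => o' q1 q2 q3 q4 q5 /= oo'.
have E : o = o' by apply/funext.
case: o' / E q1 q2 q3 q4 q5 {oo'} => q1 q2 q3 q4 q5.
by congr ClosedPoint; exact: Prop_irrelevance.
Qed.

(** Otherwise regularity at [x] implies regularity at [y], so units at [x] are units at [y] and y =
    y(t) x for a uniformizer t at [x]. Surjectivity of [y] gives y(t) = 1, hence x = y. *)
Lemma separating_pole x y : x != y -> exists a, [/\ a != 0, 0 <= x a & y a < 0].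
Proof.
move=> xy; apply: contrapT => /forallNP noa.
have xyP f : f != 0 -> 0 <= x f -> 0 <= y f.
  by move=> f0 xf; rewrite leNgt; apply/negP => yf; apply: (noa f).
have unit f : f != 0 -> x f = 0 -> y f = 0.
  move=> f0 xf; have yf : 0 <= y f by apply: xyP => //; rewrite xf.
  have : 0 <= y f^-1 by apply: xyP; rewrite ?invr_eq0// ordpV xf oppr0.
  by rewrite ordpV; lia.
pose t := uniformizer x.
have t0 : t != 0 := uniformizer_neq0 x.
have yE f : f != 0 -> y f = x f * y t.
  move=> f0; have : y (f / t ^ x f) = 0.
    apply: unit; first by rewrite mulf_neq0// invr_eq0 expfz_neq0.
    by rewrite ordpM ?invr_eq0 ?expfz_neq0// ordpV ordp_uniformizerXz subrr.
  rewrite ordpM ?invr_eq0 ?expfz_neq0// ordpV ordpXz mulrC => /eqP.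
  by rewrite subr_eq0 => /eqP.
have yt : 0 <= y t by apply: xyP; rewrite // ordp_uniformizer.
have [s s1] := ordp_surj y.
have s0 : s != 0 by apply/eqP => s0; move: s1; rewrite s0 ordp0.
have yt1 : y t = 1.
  have := yE s s0; rewrite s1; move: (x s) (y t) yt => a b b0 ab.
  by have a0 : 0 < a; nia.
move/eqP: xy; apply; apply: closed_point_eq => f.
by have [->|/yE ->] := eqVneq f 0; [rewrite !ordp0|rewrite yt1 mulr1].
Qed.

Lemma separating_zero_pole x y :
  x != y -> exists u, [/\ u != 0, 0 < x u & y u < 0].
Proof.
move=> xy; have [a [a0 xa ya]] := separating_pole xy.
rewrite eq_sym in xy; have [b [b0 yb xb]] := separating_pole xy.
exists (a / b); rewrite mulf_neq0 ?invr_eq0// !ordpM ?invr_eq0// !ordpV.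
by split=> //; lia.
Qed.

Lemma zero_and_poles x (l : seq (closed_point X)) : x \notin l ->
  exists z, [/\ z != 0, 0 < x z & forall y, y \in l -> (y : F -> int) z < 0].
Proof.
elim: l => [_|y l IH].
  exists (uniformizer x); rewrite uniformizer_neq0 ordp_uniformizer.
  by split=> // y; rewrite in_nil.
rewrite inE negb_or => /andP[xy /IH[z [z0 xz lz]]].
have [u [u0 xu yu]] := separating_zero_pole xy.
(* The exponent exceeds every |w(z)|, so at a point of the list u^r dominates if u has a pole there,
   and z dominates otherwise. *)
pose r := (\max_(w <- y :: l) absz ((w : closed_point X) z)).+1.
have rP (w : closed_point X) : w \in y :: l -> (absz (w z) < r)%N.
  by move=> wl; rewrite ltnS; apply: (leq_bigmax_mem (fun w : closed_point X => absz (w z))).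
have r0 : (0 < r)%N by [].
have ur : u ^+ r != 0 by rewrite expf_neq0.
have zux : ordp_ge x 1 (z + u ^+ r).
  by apply: ordp_geD; right => //; rewrite ordpX -mulr_natr natz; nia.
have neg (w : closed_point X) : w \in y :: l ->
    w z < 0 \/ w u < 0 -> z + u ^+ r != 0 /\ w (z + u ^+ r) < 0.
  move=> wl h; have wr := rP w wl.
  have urE : w (u ^+ r) = w u * r%:Z by rewrite ordpX -mulr_natr natz.
  have [wu|wu] := leP 0 (w u).
    have [|zu0 ->] := @ordp_eqD _ _ w z (u ^+ r) z0; last by split => //; lia.
    by right; rewrite urE; nia.
  rewrite addrC.
  have [|zu0 ->] := @ordp_eqD _ _ w (u ^+ r) z ur; last by split=> //; nia.
  by right; rewrite urE; nia.
have [zu0 _] : z + u ^+ r != 0 /\ y (z + u ^+ r) < 0.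
  by apply: neg; rewrite ?mem_head//; right.
exists (z + u ^+ r); split=> //.
  by move: zux => /ordp_geE -/(_ zu0).
move=> w wl; have [|_ //] := neg _ wl.
by move: wl; rewrite inE => /orP[/eqP ->|/lz]; [right|left].
Qed.

(** The function 1 / (1 + z^(M+1)) is close to 1 at zeros of z and close to 0 at its poles. *)
Lemma approximate_indicator x (l : seq (closed_point X)) (M : nat) :
  x \notin l -> exists s, ordp_ge x M (s - 1) /\
    forall y, y \in l -> ordp_ge y M s.
Proof.
move=> /zero_and_poles[z [z0 xz lz]].
have zM : z ^+ M.+1 != 0 by rewrite expf_neq0.
have zME (w : closed_point X) : w (z ^+ M.+1) = w z * M.+1%:Z.
  by rewrite ordpX -mulr_natr natz.
have [z10 xz1] : 1 + z ^+ M.+1 != 0 /\ x (1 + z ^+ M.+1) = x 1.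
  apply: ordp_eqD; first exact: oner_neq0.
  by right; rewrite ordp1 zME; nia.
exists (1 + z ^+ M.+1)^-1; split=> [|y yl].
  rewrite (_ : _ - 1 = - (z ^+ M.+1) / (1 + z ^+ M.+1)); last by field.
  right; rewrite ordpM ?invr_eq0 ?oppr_eq0// ordpN ordpV xz1 ordp1 zME; nia.
right; rewrite ordpV addrC; have yz := lz y yl.
have [|_ ->] := @ordp_eqD _ _ y (z ^+ M.+1) 1 zM; last by rewrite zME; nia.
by right; rewrite ordp1 zME; nia.
Qed.

Lemma weak_approximation (l : seq (closed_point X)) (g : closed_point X -> F) (N : int) :
  uniq l -> exists s, forall x, x \in l -> ordp_ge x N (s - g x).
Proof.
move=> ul.
(* [E] bounds the poles of the functions to be approximated at all points of the list; the
   indicators must be precise enough to absorb them. *)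
pose E := (\max_(y <- l) \max_(x <- l) absz ((y : closed_point X) (g x)))%N.
have EP (x y : closed_point X) : x \in l -> y \in l -> (absz (y (g x)) <= E)%N.
  move=> xl yl; apply: (@leq_trans (\max_(x <- l) absz (y (g x)))).
    exact: (leq_bigmax_mem (fun x : closed_point X => absz (y (g x)))).
  exact: (leq_bigmax_mem (fun y : closed_point X => \max_(x <- l) absz (y (g x)))%N).
pose M := (E + absz N)%N.
have /choice[s sP] (x : closed_point X) : exists s, ordp_ge x M (s - 1) /\
    forall y, y \in rem x l -> ordp_ge y M s.
  have [xl|xl] := boolP (x \in rem x l); last exact: approximate_indicator.
  by move: xl; rewrite mem_rem_uniqF.
exists (\sum_(x <- l) s x * g x) => x xl.
rewrite (perm_big _ (perm_to_rem xl)) big_cons/= addrAC -{2}[g x]mul1r -mulrBl.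
have MN (y z : closed_point X) : y \in l -> z \in l -> N <= M%:Z + z (g y).
  by move=> yl zl; have := EP y z yl zl; rewrite /M; lia.
apply: ordp_geD.
  apply: ordp_geW (ordp_geM (sP x).1 (ordp_ge_ordp x (g x))); exact: MN.
rewrite big_seq; apply: ordp_ge_sum => y yr.
have yl : y \in l by exact: mem_rem yr.
apply: ordp_geW (ordp_geM _ (ordp_ge_ordp x (g y))); first exact: (MN y x).
apply: (sP y).2; rewrite mem_rem_uniq// inE xl andbT.
by apply: contraTneq yr => ->; rewrite mem_rem_uniqF.
Qed.

Lemma ordp_poly_at_pole x f p : x f < 0 -> p != 0 ->
  p.<[f]> != 0 /\ x p.<[f]> = x f * (size p).-1%:Z.
Proof.
move=> xf; elim/poly_ind: p => [|p c IH]; first by rewrite eqxx.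
have f0 : f != 0 by apply: contraTneq xf => ->; rewrite ordp0.
rewrite poly_atD poly_atM poly_at_X poly_atC size_MXaddC.
have [-> |p0] := eqVneq p 0; rewrite /= ?poly_at0 ?mul0r ?add0r.
  rewrite polyC_eq0 => c0; rewrite fmorph_eq0 ordpC (negbTE c0) size_poly0.
  by rewrite mulr0.
have {IH}[pf0 pfE] := IH p0 => _; have pff : p.<[f]> * f != 0 by rewrite mulf_neq0.
have E : x (p.<[f]> * f) = x f * (size p)%:Z.
  rewrite ordpM// pfE -{2}[x f]mulr1 -mulrDr; congr (_ * _).
  by move: p0; rewrite -size_poly_gt0; lia.
have sp : (0 < size p)%N by rewrite size_poly_gt0.
rewrite -E; apply: ordp_eqD => //.
by right; rewrite ordpC E; nia.
Qed.

(* More than [K(X) : K(f)] poles would give, by weak approximation, a family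
   independent over K(f). *)
Lemma finite_poles f : finite_set [set x | ~ regular x f].
Proof.
apply: contrapT => inf; have [n nP] := poly_dependent f.
have [l [ul sl lA]] := infinite_uniq_seq n.+1 inf.
have lP x : x \in l -> x f < 0.
  by move=> /lA /= nreg; rewrite ltNge; apply/negP => xf; apply: nreg; right.
have x0 : closed_point X by move: sl; case: (l) => [//|y _] _; exact: y.
pose pt (i : 'I_n.+1) := nth x0 l i.
have ptl i : pt i \in l by rewrite mem_nth// sl.
(* Functions with value 1 at the i-th pole and 0 at the others. *)
have /choice[s sP] (i : 'I_n.+1) : exists s, forall x, x \in l ->
    ordp_ge x 1 (s - (x == pt i)%:R).
  exact: (weak_approximation (fun x => (x == pt i)%:R)).
have [c [[i ci] cE]] := nP s.
(* At the j-th pole a coefficient of largest degree has the deepest pole, and only its term is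
   multiplied by a function not vanishing there. *)
case: (@arg_maxnP _ i (fun j => c j != 0) (fun j => size (c j)) ci) => j cj jmax.
have xf := lP _ (ptl j); have [cf0 cfE] := ordp_poly_at_pole xf cj.
have sj : ordp_ge (pt j) 1 (s j - 1) by have := sP j _ (ptl j); rewrite eqxx.
have [s0 sE] : s j != 0 /\ pt j (s j) = 0.
  rewrite -[s j](subrK 1) addrC -(ordp1 (pt j)); apply: ordp_eqD; first exact: oner_neq0.
  by rewrite ordp1.
set e := pt j f * (size (c j)).-1%:Z in cfE.
have : ordp_ge (pt j) (e + 1) ((c j).<[f]> * s j).
  move: cE; rewrite (bigD1 j)//= => /eqP; rewrite addr_eq0 => /eqP ->.
  apply: ordp_geN; apply: ordp_ge_sum => k kj.
  apply: ordp_geM; last first.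
    have := sP k _ (ptl j); rewrite (_ : (_ == _) = false) ?subr0//.
    apply: contra_neqF kj => /eqP; rewrite /pt => /eqP.
    by rewrite nth_uniq ?sl// => /eqP/val_inj.
  have [->|ck] := eqVneq (c k) 0; first by rewrite poly_at0; left.
  right; have [_ ->] := ordp_poly_at_pole xf ck.
  by have /= := jmax k ck; rewrite /e ler_nM2l// lez_nat -!subn1; exact: leq_sub2r.
move=> /ordp_geE; rewrite mulf_neq0// => /(_ erefl).
by rewrite ordpM// sE cfE; lia.
Qed.

Lemma pole_bound f : exists N : nat, forall x, ordp_ge x (- N%:Z) f.
Proof.
have /finite_seqP[l lE] := finite_poles f.
exists (\max_(x <- l) absz ((x : closed_point X) f))%N => x.
have [xf|xf] := pselect (regular x f).
  by apply: ordp_geW xf; lia.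
have xl : x \in l by have : [set` l] x by rewrite -lE.
have := leq_bigmax_mem (fun x : closed_point X => absz (x f)) xl.
by move=> le; right; lia.
Qed.

Lemma finite_form_poles (K_char0 : [pchar K] =i pred0) (w : meroform X) :
  finite_set [set x | ~ form_regular x w].
Proof.
(* The auxiliary point comes from the set of poles itself, since the existence of points is
   established only later. The form is then regular wherever its coefficient and the uniformizer of
   [x0] are. *)
have [->|/set0P[x0 _]] := eqVneq [set x | ~ form_regular x w] set0.
  exact: finite_set0.
have fin : finite_set ([set x | ~ regular x (form_coef x0 w)] `|`
    [set x | ~ regular x (uniformizer x0)]).
  by rewrite finite_setU; split; exact: finite_poles.
apply: sub_finite_set fin => x /= wx.
have [fx|fx] := pselect (regular x (form_coef x0 w)); last by left.
right => tx; apply: wx; rewrite -(form_coefE K_char0 x0 w).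
by apply: form_regularZ => //; exact: form_regular_df.
Qed.

End Approximation.

(** * Existence of points *)

Section ExistenceOfPoints.
Variables (K : closedFieldType) (X : curve K) (u : ratfun X).
Local Notation F := (ratfun X).
Local Notation cst := (kconst X).
Local Notation "p .<[ t ]>" := (poly_at cst p t) (at level 2, left associativity).
Hypothesis u_not_cst : forall c, u <> cst c.

(** * Maximal subrings in which [u] is not invertible *)

Let subring (R : set F) := [/\ forall c, R (cst c), R u,
  forall a b, R a -> R b -> R (a + b) & forall a b, R a -> R b -> R (a * b)].

Let good (R : set F) := subring R /\ forall r, R r -> u * r <> 1.

Let maximal_good : exists O, good O /\ forall R, good R -> O `<=` R -> R `<=` O.
Proof.
have [|A [[A0|gA] Amax]] := @Zorn_bigcup F (fun R => R = set0 \/ good R).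
- move=> C CP Ctot.
  have [C0|] := pselect (forall R, C R -> R = set0).
    left; apply/seteqP; split=> // a [R CR Ra].
    by have : set0 a by rewrite -(C0 R CR).
  move=> /existsNP[R0 /not_implyP[CR0 R00]]; right.
  have gC R a : C R -> R a -> good R.
    by move=> /CP[->|//].
  have [[R0c R0u _ _] _] : good R0 by case: (CP _ CR0).
  have join a b : (\bigcup_(R in C) R) a -> (\bigcup_(R in C) R) b ->
      exists R, [/\ C R, good R, R a & R b].
    move=> [R CR Ra] [S CS Sb]; have [RS|SR] := Ctot _ _ CR CS.
      by exists S; split=> //; [exact: gC Sb|exact: RS].
    by exists R; split=> //; [exact: gC Ra|exact: SR].
  split; first split.
  + by move=> c; exists R0.
  + by exists R0.
  + by move=> a b aC bC; have [R [CR [[_ _ RD _] _] Ra Rb]] := join a b aC bC; exists R => //; exact: RD.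
  + by move=> a b aC bC; have [R [CR [[_ _ _ RM] _] Ra Rb]] := join a b aC bC; exists R => //; exact: RM.
  + by move=> r [R CR Rr]; have [_] := gC R r CR Rr; apply.
- exfalso; apply: (Amax [set r | exists p, r = p.<[u]>]).
    rewrite A0; split; first by move=> a [].
    by move=> /(_ (cst 0)) /=; apply; exists 0; rewrite rmorph0 poly_at0.
  right; split; first split.
  + by move=> c; exists c%:P; rewrite poly_atC.
  + by exists 'X; rewrite poly_at_X.
  + by move=> a b [p ->] [q ->]; exists (p + q); rewrite poly_atD.
  + by move=> a b [p ->] [q ->]; exists (p * q); rewrite poly_atM.
  + move=> r [p ->] up; have [h|[c uc]] := transcendental_or_cst u; last exact: (u_not_cst uc).
    have /h/eqP : 'X * p - 1 != 0 :> {poly K}.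
      apply/eqP => /(congr1 (fun q => q.[0])); rewrite hornerD hornerM hornerX hornerN hornerC horner0.
      by rewrite mul0r sub0r => /eqP; rewrite oppr_eq0 oner_eq0.
    by rewrite poly_atB poly_atM poly_at_X poly_at1 up subrr.
- exists A; split=> // R gR AR; apply: contrapT => RA.
  by apply: (Amax R); [split|right].
Qed.

Let O := projT1 (cid maximal_good).

Let O_good : good O. Proof. exact: (projT2 (cid maximal_good)).1. Qed.

Let O_max R : good R -> O `<=` R -> R `<=` O.
Proof. exact: (projT2 (cid maximal_good)).2. Qed.

Let Oc c : O (cst c). Proof. by have [[]] := O_good. Qed.
Let Ou : O u. Proof. by have [[]] := O_good. Qed.
Let OD a b : O a -> O b -> O (a + b). Proof. by have [[_ _ h _] _] := O_good; exact: h. Qed.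
Let OM a b : O a -> O b -> O (a * b). Proof. by have [[_ _ _ h] _] := O_good; exact: h. Qed.
Let uO r : O r -> u * r <> 1. Proof. by have [_ h] := O_good; exact: h. Qed.
Let O0 : O 0. Proof. by rewrite -(rmorph0 cst). Qed.
Let O1 : O 1. Proof. by rewrite -(rmorph1 cst). Qed.
Let ON a : O a -> O (- a).
Proof. by move=> Oa; rewrite -mulN1r -(rmorph1 cst) -rmorphN; exact: OM. Qed.
Let OX a n : O a -> O (a ^+ n).
Proof. by move=> Oa; elim: n => [//|n IH]; rewrite exprS; exact: OM. Qed.
Let Osum (I : Type) (r : seq I) (P : pred I) (f : I -> F) :
  (forall i, P i -> O (f i)) -> O (\sum_(i <- r | P i) f i).
Proof. by move=> h; elim/big_ind: _ => //; exact: OD. Qed.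
Let Opoly p a : O a -> O p.<[a]>.
Proof.
by move=> Oa; rewrite poly_at_coef; apply: Osum => i _; apply: OM => //; exact: OX.
Qed.

Let u0 : u != 0. Proof. by apply/eqP => u0; apply: (u_not_cst (c := 0)); rewrite rmorph0. Qed.

(** Inverting all elements 1 + u b keeps [u] a nonunit, since u a = 1 + u b gives u (a - b) = 1. By
    maximality the inverses already lie in [O]. *)
Let one_plus_unit r : O r -> 1 + u * r != 0 /\ O (1 + u * r)^-1.
Proof.
have nz b : O b -> 1 + u * b != 0.
  move=> Ob; apply/eqP => ub; apply: (uO (ON Ob)).
  by rewrite mulrN -[RHS](addrK (u * b)) ub sub0r.
move=> Or; split; first exact: nz.
pose R : set F := [set z | exists a b, [/\ O a, O b & z = a / (1 + u * b)]].
have RO a : O a -> R a.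
  by move=> Oa; exists a, 0; rewrite mulr0 addr0 divr1.
apply: (@O_max R) => //; last by exists 1, r; rewrite div1r.
split; first split.
- by move=> c; exact: RO.
- exact: RO.
- move=> _ _ [a [b [Oa Ob ->]]] [a' [b' [Oa' Ob' ->]]].
  exists (a * (1 + u * b') + a' * (1 + u * b)), (b + b' + u * b * b'); split.
  + by apply: OD; apply: OM => //; apply: OD => //; exact: OM.
  + by apply: OD; [exact: OD|apply: OM => //; exact: OM].
  + rewrite (_ : 1 + u * (b + b' + u * b * b') = (1 + u * b) * (1 + u * b')); last by ring.
    by field; rewrite !nz.
- move=> _ _ [a [b [Oa Ob ->]]] [a' [b' [Oa' Ob' ->]]].
  exists (a * a'), (b + b' + u * b * b'); split; first exact: OM.
  + by apply: OD; [exact: OD|apply: OM => //; exact: OM].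
  + rewrite (_ : 1 + u * (b + b' + u * b * b') = (1 + u * b) * (1 + u * b')); last by ring.
    by field; rewrite !nz.
- move=> _ [a [b [Oa Ob ->]]] uab; apply: (@uO (a - b)).
    by apply: OD => //; exact: ON.
  have := congr1 ( *%R^~ (1 + u * b)) uab; rewrite /= mul1r mulrA divfK ?nz// => uaE.
  by rewrite mulrBr uaE addrK.
Qed.

(** Says that [u] becomes invertible in O[y]; [k] counts coefficients, so the degree is below
    [k]. *)
Let rel_of_degree (y : F) k := exists a : nat -> F, (forall i, O (a i)) /\
  u * (\sum_(i < k) a i * y ^+ i) = 1.

(** The descent showing that a maximal subring is a valuation ring: the shorter of the two relations
    expresses the top power in the longer one through lower powers. *)
Let no_two_relations N y k l : (k + l <= N)%N -> y != 0 ->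
  rel_of_degree y k -> rel_of_degree y^-1 l -> False.
Proof.
elim: N y k l => [|N IH] y k l.
  rewrite leqn0 addn_eq0 => /andP[/eqP -> _] _ [a [_]].
  by rewrite big_ord0 mulr0 => /esym/eqP; rewrite oner_eq0.
wlog lk : y k l / (l <= k)%N.
  move=> hw kl y0 yk yl; have [lk|/ltnW kl'] := leqP l k; first exact: (hw y k l).
  apply: (hw y^-1 l k); rewrite ?invr_eq0// 1?addnC// invrK //.
case: k lk => [|k] lk kl y0 [a [Oa ay]] [b [Ob bl]].
  by move: ay; rewrite big_ord0 mulr0 => /esym/eqP; rewrite oner_eq0.
apply: (IH y k l); [by lia|by []| |by exists b].
pose b' j := if (j < l)%N then b j else 0.
have Ob' j : O (b' j) by rewrite /b'; case: ifP.
have b'y : u * (\sum_(j < k.+1) b' j * y^-1 ^+ j) = 1.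
  rewrite (bigID (fun j : 'I_k.+1 => (j < l)%N))/= [X in _ + X]big1 ?addr0.
    rewrite (big_ord_narrow lk) -[RHS]bl; congr (_ * _); apply: eq_bigr => j _ /=.
    by rewrite /b' ltn_ord.
  by move=> j /negbTE jl; rewrite /b' jl mul0r.
have [v0 Os] := one_plus_unit (ON (Ob' 0%N)).
set s := (1 + u * - b' 0%N)^-1 in Os.
(* The relation for 1/y, padded with zeros and multiplied by y^k, reads (1 - u b_0) y^k = u times
   lower powers, and 1 - u b_0 is a unit. *)
have yk : y ^+ k = s * u * \sum_(i < k) b' (k - i)%N * y ^+ i.
  apply: (mulfI v0); rewrite /s -mulrA mulVKf//.
  have : u * (\sum_(i < k.+1) b' (k - i)%N * y ^+ i) = y ^+ k.
    rewrite -[RHS]mulr1 -b'y mulrCA; congr (_ * _); rewrite mulr_sumr.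
    rewrite (reindex_inj rev_ord_inj)/=; apply: eq_bigr => i _.
    have ik : (i <= k)%N by rewrite -ltnS.
    rewrite subSS subKn// mulrCA exprVn; congr (_ * _).
    have -> : y ^+ k = y ^+ (k - i) * y ^+ i by rewrite -exprD subnK.
    by rewrite mulfK// expf_neq0.
  rewrite big_ord_recr/= subnn => E.
  by rewrite mulrDl mul1r -{1}E; ring.
exists (fun i => a i + a k * (s * u * b' (k - i)%N)); split=> [i|].
  by apply: OD => //; apply: OM => //; apply: OM => //; exact: OM.
rewrite -[RHS]ay big_ord_recr/= yk; congr (_ * _).
rewrite !mulr_sumr -big_split/=; apply: eq_bigr => i _; ring.
Qed.

Let adjoin y : ~ O y -> exists k, rel_of_degree y k.
Proof.
move=> nOy; apply: contrapT => norel.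
pose R : set F := [set z | exists p : {poly F}, (forall i, O p`_i) /\ z = p.[y]].
have RO a : O a -> R a.
  move=> Oa; exists a%:P; rewrite hornerC; split=> // i.
  by rewrite coefC; case: ifP.
apply: nOy; apply: (@O_max R) => //; last first.
  by exists 'X; rewrite hornerX; split=> // i; rewrite coefX; case: eqP.
split; first split.
- by move=> c; exact: RO.
- exact: RO.
- move=> _ _ [p [Op ->]] [q [Oq ->]]; exists (p + q); rewrite hornerD; split=> // i.
  by rewrite coefD; exact: OD.
- move=> _ _ [p [Op ->]] [q [Oq ->]]; exists (p * q); rewrite hornerM; split=> // i.
  by rewrite coefM; apply: Osum => j _; exact: OM.
- move=> _ [p [Op ->]] up; apply: norel; exists (size p), (fun i => p`_i).
  by split=> //; rewrite -horner_coef.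
Qed.

(** * The valuation ring and its maximal ideal *)

Let valuation_ring y : O y \/ O y^-1.
Proof.
have [->|y0] := eqVneq y 0; first by left.
apply: contrapT => /not_orP[/adjoin[k yk] /adjoin[l yl]].
exact: (no_two_relations (leqnn (k + l)) y0 yk yl).
Qed.

(** The maximal ideal. Zero is listed apart because [0^-1] is 0, which lies in [O]. *)
Let M z := z = 0 \/ ~ O z^-1.

Let M_O z : M z -> O z.
Proof. by case=> [->//|nz]; case: (valuation_ring z). Qed.

Let MMl a b : M a -> O b -> M (a * b).
Proof.
move=> [->|na] Ob; first by left; rewrite mul0r.
have [->|b0] := eqVneq b 0; first by left; rewrite mulr0.
right=> Oab; apply: na; have := OM Ob Oab.
by rewrite invfM mulrCA divff// mulr1.
Qed.

Let MD a b : M a -> M b -> M (a + b).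
Proof.
move=> Ma Mb; have [a0|a0] := eqVneq a 0; first by rewrite a0 add0r.
have [b0|b0] := eqVneq b 0; first by rewrite b0 addr0.
have [Oab|Oba] := valuation_ring (a / b).
  rewrite (_ : a + b = b * (a / b + 1)); last by field.
  by apply: MMl => //; apply: OD.
rewrite (_ : a + b = a * ((a / b)^-1 + 1)); last by field; rewrite a0 b0.
by apply: MMl => //; apply: OD => //; rewrite invf_div.
Qed.

Let Msum (I : Type) (r : seq I) (P : pred I) (f : I -> F) :
  (forall i, P i -> M (f i)) -> M (\sum_(i <- r | P i) f i).
Proof. by move=> h; elim/big_ind: _ => //; left. Qed.

Let Mu : M u.
Proof. by right=> Ouv; apply: (uO Ouv); rewrite divff. Qed.

Let M_cst c : M (cst c) -> c = 0.
Proof.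
case=> [/eqP|]; first by rewrite fmorph_eq0 => /eqP.
by rewrite -fmorphV => /(_ (Oc _)).
Qed.

(** A strictly increasing chain of principal ideals from (v) to (c n), all inside [M]. *)
Let chain n v (c : nat -> F) := [/\ c 0%N = v, forall i, c i != 0,
  M (c n) & forall i, (i < n)%N -> M (c i / c i.+1)].

(* The members of a chain are linearly independent over K(v). *)
Let no_long_chain v : M v -> v != 0 -> exists n, forall c, ~ chain n v c.
Proof.
move=> Mv v0; have [n nP] := poly_dependent v; exists n => c [c0 cn0 Mcn cM].
have ratio i j : (i < j)%N -> (j <= n)%N -> M (c i / c j).
  elim: j => // j IH; rewrite ltnS leq_eqVlt => /orP[/eqP ->|ij] jn; first exact: cM.
  rewrite (_ : _ / _ = c i / c j * (c j / c j.+1)); last by field; rewrite !cn0.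
  by apply: MMl; [apply: IH => //; exact: ltnW|apply: M_O; exact: cM].
have McE i : (i <= n)%N -> M (c i).
  rewrite leq_eqVlt => /orP[/eqP ->//|ni].
  rewrite -[c i](divfK (cn0 n)) mulrC; apply: MMl => //.
  by apply: M_O; exact: ratio.
have [p [[i0 pi0] pE]] := nP (fun i => c i).
have [q [[i1 qi1] qE]] : exists q : 'I_n.+1 -> {poly K},
    (exists i, (q i)`_0 != 0) /\ \sum_i (q i).<[v]> * c i = 0.
  elim: (size (p i0)) {-2}p (leqnn (size (p i0))) pi0 pE => [|s IH] q.
    by rewrite leqn0 size_poly_eq0 => ->.
  move=> qs q0 qE.
  have [[i qi]|/forallNP q00] := pselect (exists i, (q i)`_0 != 0).
    by exists q; split=> //; exists i.
  have qX i : q i = 'X * (q i %/ 'X).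
    rewrite mulrC divpK// -['X]subr0 -polyC0 dvdp_XsubCl /root horner_coef0.
    by apply/negPn/negP; exact: q00.
  apply: (IH (fun i => q i %/ 'X)).
  - by rewrite size_divp ?polyX_eq0// size_polyX leq_subLR; exact: qs.
  - by apply: contra q0 => /eqP q0; rewrite qX q0 mulr0.
  - apply: (mulfI v0); rewrite mulr0 -[RHS]qE mulr_sumr; apply: eq_bigr => i _.
    by rewrite [in RHS]qX poly_atM poly_at_X mulrA.
(* Let [j] be the last index with nonzero constant term. After division by c j all other terms lie
   in [M]: those before j by the ratios, those after j because their coefficients are divisible by v
   = c 0, hence by c j. The constant term at j is then in [M], hence zero. *)
case: (@arg_maxnP _ i1 (fun j => (q j)`_0 != 0) (fun j => j : nat) qi1) => j qj jmax.
have qX (r : {poly K}) : exists r', r.<[v]> = cst r`_0 + v * r' /\ O r'.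
  elim/poly_ind: r => [|r a _].
    by exists 0; rewrite poly_at0 coef0 rmorph0 mulr0 addr0.
  exists r.<[v]>; rewrite poly_atD poly_atM poly_at_X poly_atC coefD coefMX coefC/=.
  by rewrite add0r addrC mulrC; split=> //; apply: Opoly; exact: M_O.
have [r [qjE Or]] := qX (q j).
apply/negP: qj; apply/negPn/eqP/M_cst.
have -> : cst (q j)`_0 = (q j).<[v]> + v * - r by rewrite qjE; ring.
apply: MD; last by apply: MMl => //; exact: ON.
have -> : (q j).<[v]> = \sum_(i < n.+1 | i != j) c i / c j * - (q i).<[v]>.
  apply: (mulIf (cn0 j)); move: qE; rewrite (bigD1 j)//= => /eqP.
  rewrite addr_eq0 => /eqP ->; rewrite mulr_suml -sumrN; apply: eq_bigr => i _.
  by field; exact: cn0.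
have Oq i : O (q i).<[v]> by apply: Opoly; exact: M_O.
apply: Msum => i ij; have [lt_ij|lt_ji|/val_inj E] := ltngtP i j.
- by apply: MMl; [apply: ratio => //; rewrite -ltnS|exact: ON].
- have qi0 : (q i)`_0 = 0.
    by apply/eqP/negPn/negP => /jmax /=; rewrite leqNgt lt_ji.
  have [r' [-> Or']] := qX (q i); rewrite qi0 rmorph0 add0r.
  rewrite (_ : _ * _ = c i * (v / c j * - r')); last by field; exact: cn0.
  apply: MMl; first by apply: McE; rewrite -ltnS.
  apply: OM; last exact: ON.
  rewrite -c0; have [->|j0] := eqVneq (val j) 0%N; first by rewrite divff.
  by apply: M_O; apply: ratio; rewrite ?lt0n// -ltnS.
- by rewrite E eqxx in ij.
Qed.

(** If no element generated [M], every nonzero element of [M] would be a proper multiple of another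
    one, and chains of any length would start at [u]. *)
Let local_parameter : exists t, [/\ M t, t != 0 & forall z, M z -> O (z / t)].
Proof.
apply: contrapT => /forallNP not.
have /choice[s sP] t : exists z, M t -> t != 0 -> [/\ M z, z != 0 & M (t / z)].
  have [[Mt t0]|nt] := pselect (M t /\ t != 0); last by exists 0 => Mt t0; case: nt.
  have /existsNP[z /not_implyP[Mz nzt]] : ~ forall z, M z -> O (z / t).
    by move=> h; apply: (not t).
  exists z => _ _; split=> //; last by right; rewrite invf_div.
  by apply/eqP => z0; apply: nzt; rewrite z0 mul0r.
have [n] := no_long_chain Mu u0; apply.
pose c i := iter i s u; apply: (_ : chain n u c).
have cP i : M (c i) /\ c i != 0.
  by elim: i => [//|i [Mi i0]]; have [] := sP _ Mi i0.
split=> [//|i||i _]; [exact: (cP i).2|exact: (cP n).1|].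
by have [Mi i0] := cP i; have [] := sP _ Mi i0.
Qed.

Let t := projT1 (cid local_parameter).
Let Mt : M t. Proof. by have [] := projT2 (cid local_parameter). Qed.
Let t0 : t != 0. Proof. by have [] := projT2 (cid local_parameter). Qed.
Let tP z : M z -> O (z / t).
Proof. by have [_ _ h] := projT2 (cid local_parameter); exact: h. Qed.

(** * The discrete valuation *)

Let unit z := O z /\ O z^-1.

Let unitM a b : unit a -> unit b -> unit (a * b).
Proof. by move=> [Oa Oa'] [Ob Ob']; rewrite /unit invfM; split; exact: OM. Qed.

Let unitV a : unit a -> unit a^-1.
Proof. by case=> Oa Oa'; split; rewrite ?invrK. Qed.

Let nonunit z : O z -> ~ unit z -> M z.
Proof. by move=> Oz nz; right=> Oz'; exact: nz. Qed.

Let O_factor z : z != 0 -> O z -> exists k : nat, unit (z / t ^+ k).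
Proof.
move=> z0 Oz; apply: contrapT => /forallNP nu.
have Mk k : M (z / t ^+ k).
  elim: k => [|k IH]; first by apply: nonunit => //; rewrite expr0 divr1.
  apply: nonunit => //; rewrite exprSr invfM mulrA; exact: tP.
have Mz : M z by have := Mk 0%N; rewrite expr0 divr1.
have [n] := no_long_chain Mz z0; apply.
(* If [z] were divisible by every power of t, then z, t^n, ..., t would be a chain of forbidden
   length. *)
pose c i := if i is j.+1 then t ^+ (n.+1 - i) else z.
apply: (_ : chain n z c); split=> [//|[|i]||[|i] iN]; rewrite /c ?expf_neq0//.
- case: n {c} => // n; by rewrite subSnn expr1.
- by rewrite !subSS -(subnSK (ltnW iN)) exprS mulfK ?expf_neq0.
Qed.

Let factor f : f != 0 -> exists n : int, unit (f / t ^ n).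
Proof.
move=> f0; have [Of|Of] := valuation_ring f.
  by have [k fk] := O_factor f0 Of; exists k%:Z.
have [|k fk] := O_factor _ Of; first by rewrite invr_eq0.
exists (- k%:Z); move/unitV: fk.
by rewrite invfM !invrK -exprnN invrK.
Qed.

Let unit_txn n : unit (t ^ n) -> n = 0.
Proof.
have pos k : ~ unit (t ^+ k.+1).
  move=> [_]; rewrite exprS => h; have : M (t * t ^+ k) by apply: MMl => //; apply: OX; exact: M_O.
  by case=> // /eqP; rewrite mulf_eq0 (negbTE t0) expf_eq0 (negbTE t0) andbF.
case: n => [[//|k]/pos//|k]; rewrite NegzE => /unitV.
by rewrite -exprnN invrK => /pos.
Qed.

Let v f : int := if f == 0 then 0 else xget 0 [set n : int | unit (f / t ^ n)].

Let vP f : f != 0 -> unit (f / t ^ v f).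
Proof.
move=> f0; rewrite /v (negbTE f0).
exact: (@xgetPex _ 0 [set n : int | unit (f / t ^ n)] (factor f0)).
Qed.

Let v_uniq f n : f != 0 -> unit (f / t ^ n) -> v f = n.
Proof.
move=> f0 fn; have := unitM (vP f0) (unitV fn).
rewrite invfM invrK mulrA [f / _ / f]mulrAC divff// mul1r mulrC => h.
apply/eqP; rewrite eq_sym -subr_eq0; apply/eqP/unit_txn.
by rewrite expfzDr// -invr_expz.
Qed.

Let v_ge0 f : O f -> 0 <= v f.
Proof.
have [->|f0] := eqVneq f 0; first by rewrite /v eqxx.
by move=> Of; have [k fk] := O_factor f0 Of; rewrite (@v_uniq f k).
Qed.

Let v0 : v 0 = 0. Proof. by rewrite /v eqxx. Qed.

Let vM f g : f != 0 -> g != 0 -> v (f * g) = v f + v g.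
Proof.
move=> f0 g0; apply: v_uniq; first by rewrite mulf_neq0.
by rewrite expfzDr// invfM mulrACA; apply: unitM; exact: vP.
Qed.

Let v_geO f n : f != 0 -> O (f / t ^ n) -> n <= v f.
Proof.
move=> f0 /v_ge0; rewrite vM ?invr_eq0 ?expfz_neq0//.
rewrite (@v_uniq (t ^ n)^-1 (- n)) ?invr_eq0 ?expfz_neq0//; first by lia.
by rewrite invr_expz divff ?expfz_neq0//; split; rewrite ?invr1.
Qed.

Let O_ge f n : f != 0 -> n <= v f -> O (f / t ^ n).
Proof.
move=> f0 nf; rewrite (_ : f / _ = f / t ^ v f * t ^ (v f - n)).
  apply: OM; first exact: (vP f0).1.
  by rewrite (_ : v f - n = absz (v f - n)%R); [apply: OX; exact: M_O|lia].
by rewrite expfzDr// -invr_expz mulrA divfK ?expfz_neq0.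
Qed.

Let vD f g : f != 0 -> g != 0 -> f + g != 0 -> Num.min (v f) (v g) <= v (f + g).
Proof.
move=> f0 g0 fg0; apply: v_geO => //; rewrite mulrDl.
by apply: OD; apply: O_ge; rewrite // ge_min lexx ?orbT.
Qed.

Let vC c : v (cst c) = 0.
Proof.
have [->|c0] := eqVneq c 0; first by rewrite rmorph0.
by apply: v_uniq; rewrite ?fmorph_eq0// expr0z divr1; split; rewrite -?fmorphV.
Qed.

Let vt : exists t, v t = 1.
Proof.
exists t; apply: v_uniq => //; rewrite expr1z divff//.
by split; rewrite ?invr1.
Qed.

Lemma exists_zero : exists x : closed_point X, 0 < x u.
Proof.
exists (ClosedPoint v0 vM vD vC vt) => /=.
rewrite lt0r (v_ge0 Ou) andbT; apply/eqP => vu0.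
have [_] := vP u0; rewrite vu0 expr0z divr1.
by case: Mu => // /eqP; rewrite (negbTE u0).
Qed.

End ExistenceOfPoints.

Section Constants.
Variables (K : closedFieldType) (X : curve K).
Local Notation F := (ratfun X).
Local Notation cst := (kconst X).

Lemma exists_pole (f : F) : (forall c, f <> cst c) -> exists x : closed_point X, x f < 0.
Proof.
move=> fc; have [|x] := @exists_zero K X f^-1.
  by move=> c /(congr1 (fun z => z^-1)); rewrite invrK -fmorphV; exact: fc.
by rewrite ordpV oppr_gt0 => xf; exists x.
Qed.

Lemma everywhere_regular_cst (f : F) :
  (forall x : closed_point X, regular x f) -> exists c, f = cst c.
Proof.
move=> freg; apply: contrapT => /forallNP /exists_pole[x xf].
have := freg x; rewrite /regular => /ordp_geE h.
have f0 : f != 0 by apply: contraTneq xf => ->; rewrite ordp0.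
by have := h f0; rewrite leNgt xf.
Qed.

Lemma exists_point : exists x : closed_point X, True.
Proof.
have [t [tP _]] := ratfunP X; have [|x _] := @exists_zero K X t; last by exists x.
move=> c tc; have : 'X - c%:P != 0 :> {poly K} by rewrite polyXsubC_eq0.
by move=> /tP; rewrite poly_atB poly_at_X poly_atC tc subrr eqxx.
Qed.

End Constants.

(** * Strong approximation *)

Section StrongApproximation.
Variables (K : closedFieldType) (X : curve K) (h : ratfun X).
Local Notation F := (ratfun X).
Local Notation cst := (kconst X).
Local Notation "p .<[ t ]>" := (poly_at cst p t) (at level 2, left associativity).
Hypothesis h_not_cst : forall c, h <> cst c.
Implicit Types (x y : closed_point X) (f g : F).

Let h_transcendental p : p != 0 -> p.<[h]> != 0.
Proof. by case: (transcendental_or_cst h) => [|[c hc]]; [exact|case: (h_not_cst hc)]. Qed.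

Lemma not_regular x f : ~ regular x f <-> x f < 0.
Proof.
split=> [nf|xf].
  by rewrite ltNge; apply/negP => xf; apply: nf; right.
case=> [f0|]; first by move: xf; rewrite f0 ordp0.
by rewrite leNgt xf.
Qed.

Let val_exists : exists v : closed_point X -> K,
  forall x, regular x h -> ordp_ge x 1 (h - cst (v x)).
Proof.
suff /choice[v vP] : forall x, exists c, regular x h -> ordp_ge x 1 (h - cst c) by exists v.
move=> x; have [/residue_field[c hc]|nh] := pselect (regular x h); first by exists c.
by exists 0 => /nh.
Qed.

(** A pole of [f] at a point x where [h] is regular is removed by a power of h - h(x). *)
Let clear_poles f : exists Q, Q != 0 /\ forall x, regular x h -> regular x (Q.<[h]> * f).
Proof.
have [v vP] := val_exists.
have /finite_seqP[l lE] := finite_poles f.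
have [k kP] := pole_bound f.
exists ((\prod_(x <- l) ('X - (v x)%:P)) ^+ k); split.
  by rewrite expf_neq0// monic_neq0// monic_prod_XsubC.
move=> x hx; have [fx|fx] := pselect (regular x f).
  by apply: regularM => //; exact: regular_poly_at.
have xl : x \in l by have : [set` l] x by rewrite -lE.
rewrite /regular -(addrN k%:Z); apply: ordp_geM (kP x).
rewrite poly_atXn -[k%:Z]natz; apply: ordp_geX.
rewrite (big_rem x)//= poly_atM -[1]addr0; apply: ordp_geM.
  by rewrite poly_atB poly_at_X poly_atC; exact: vP.
exact: regular_poly_at.
Qed.

(** [Q] vanishes at the values of [h] on the bad points of [g], and [Z] is the finite set of zeros
    of Q(h). A weak approximation [a] on [Z] may have poles elsewhere; it is multiplied by a
    polynomial in [h] that is 1 modulo Q^k and 0 modulo R^k, where [R] vanishes at the values of [h]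
    at those other poles. *)
Lemma strong_approximation_off_poles (g : closed_point X -> F) :
  finite_set [set x | ~ regular x (g x)] ->
  exists u, forall x, regular x h -> regular x (u - g x).
Proof.
move=> /finite_seqP[T TE]; have [v vP] := val_exists.
pose Q := \prod_(x <- T) ('X - (v x)%:P).
have Q0 : Q != 0 by rewrite monic_neq0// monic_prod_XsubC.
have /finite_seqP[Z ZE] := finite_poles (Q.<[h]>^-1).
have ZP x : x \in Z <-> 0 < x Q.<[h]>.
  rewrite -oppr_lt0 -ordpV -not_regular.
  have -> : (x \in Z : Prop) = [set` Z] x by [].
  by rewrite -ZE.
have rootZ x : regular x h -> root Q (v x) -> x \in Z.
  move=> hx /factor_theorem[q qE]; apply/ZP.
  have : ordp_ge x 1 Q.<[h]>.
    rewrite qE poly_atM poly_atB poly_at_X poly_atC -[1]add0r.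
    by apply: ordp_geM; [exact: regular_poly_at|exact: vP].
  by move=> /ordp_geE; apply; exact: h_transcendental.
have [a aP] := weak_approximation g 0 (undup_uniq Z).
have [k kP] := pole_bound a.
have /finite_seqP[W WE] := finite_poles a.
pose W' := [seq w <- W | (w \notin Z) && `[< regular w h >]].
pose R := \prod_(w <- W') ('X - (v w)%:P).
(* A common root would be the value of [h] at a point off [Z] where Q(h) vanishes. *)
have QR : coprimep (Q ^+ k) (R ^+ k).
  apply/coprimep_expl/coprimep_expr; rewrite /R big_seq.
  elim/big_ind: _ => [||w]; first exact: coprimep1.
    by move=> p q Qp Qq; rewrite coprimepMr Qp.
  rewrite mem_filter => /andP[/andP[wZ /asboolP hw] _].
  rewrite coprimep_XsubC; apply: contra wZ; exact: rootZ.
have [[p1 p2] /= pE] : exists pq : {poly K} * {poly K}, pq.1 * Q ^+ k + pq.2 * R ^+ k = 1.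
  have [[q1 q2] /=] := Bezout_coprimepP _ _ QR.
  rewrite -size_poly_eq1 => /size_poly1P[c c0 cE].
  exists (c^-1%:P * q1, c^-1%:P * q2) => /=.
  by rewrite -!mulrA -mulrDr cE -polyCM mulVf.
exists (a * (p2 * R ^+ k).<[h]>) => x hx.
have [xZ|xZ] := boolP (x \in Z).
  have -> : a * (p2 * R ^+ k).<[h]> - g x = (a - g x) - a * ((p1.<[h]>) * Q.<[h]> ^+ k).
    have -> : p2 * R ^+ k = 1 - p1 * Q ^+ k by rewrite -pE addrAC subrr add0r.
    by rewrite poly_atB poly_at1 poly_atM poly_atXn; ring.
  apply: ordp_geB; first by apply: aP; rewrite mem_undup.
  rewrite -(addNr k%:Z); apply: ordp_geM (kP x) _.
  rewrite -[k%:Z]add0r; apply: ordp_geM; first exact: regular_poly_at.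
  by rewrite -[k%:Z]natz; apply: ordp_geX; right; move/ZP: xZ; lia.
apply: ordp_geB; last first.
  apply: contrapT => gx; move/negP: xZ; apply; apply: rootZ => //.
  have xT : x \in T by have : [set` T] x by rewrite -TE.
  by rewrite /Q (big_rem x)//= rootM root_XsubC eqxx.
have [ax|ax] := pselect (regular x a); first by apply: regularM => //; exact: regular_poly_at.
rewrite -(addNr k%:Z); apply: ordp_geM (kP x) _.
rewrite poly_atM -[k%:Z]add0r; apply: ordp_geM; first exact: regular_poly_at.
rewrite poly_atXn -[k%:Z]natz; apply: ordp_geX.
have xW : x \in W' by rewrite mem_filter xZ asboolT//=; have : [set` W] x by rewrite -WE.
rewrite /R (big_rem x)//= poly_atM -[1]addr0; apply: ordp_geM.
  by rewrite poly_atB poly_at_X poly_atC; exact: vP.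
exact: regular_poly_at.
Qed.

(* With generators y_i of K(X) over K(h) regular off the poles of h, write the
   coordinates of an element as a polynomial in h plus a proper fraction. *)
Lemma strong_approximation_at_poles : exists M : nat,
  forall g : closed_point X -> F, exists a,
    (forall x, regular x h -> regular x a) /\
    forall x, ~ regular x h -> ordp_ge x (- M%:Z) (a - g x).
Proof.
have [n [y yP]] := finite_span h.
have /choice[Q QP] i := clear_poles (y i).
pose z i := (Q i).<[h]> * y i.
have zP f : exists c, c != 0 /\ exists p : 'I_n -> {poly K},
    c.<[h]> * f = \sum_i (p i).<[h]> * z i.
  have [c [c0 [p pE]]] := yP f.
  exists (c * \prod_i Q i); split.
    by rewrite mulf_neq0//; apply/prodf_neq0 => i _; exact: (QP i).1.
  exists (fun i => p i * \prod_(j | j != i) Q j).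
  rewrite poly_atM mulrAC pE mulr_suml; apply: eq_bigr => i _.
  by rewrite (bigD1 i)//= !poly_atM /z; ring.
have /choice[N NP] i := pole_bound (z i).
have /finite_seqP[S SE] := finite_poles h.
(* The bound is the pole order of the fixed generators alone, hence independent of [g]. *)
exists (\max_i N i)%N => g.
have [b bP] := weak_approximation g 0 (undup_uniq S).
have [c [c0 [p pE]]] := zP b.
exists (\sum_i (p i %/ c).<[h]> * z i); split=> [x hx|x hx].
  apply: ordp_ge_sum => i _; apply: regularM; first exact: regular_poly_at.
  exact: (QP i).2.
have xS : x \in undup S by rewrite mem_undup; have : [set` S] x by rewrite -SE.
have -> : \sum_i (p i %/ c).<[h]> * z i - g x =
    (b - g x) - \sum_i ((p i %% c).<[h]> / c.<[h]>) * z i.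
  suff -> : b = \sum_i (p i %/ c).<[h]> * z i +
    \sum_i ((p i %% c).<[h]> / c.<[h]>) * z i by ring.
  have ch := h_transcendental c0.
  apply: (mulfI ch); rewrite pE -big_split mulr_sumr; apply: eq_bigr => i _ /=.
  rewrite {1}(divp_eq (p i) c) poly_atD poly_atM; field; exact: ch.
apply: ordp_geB; first by apply: ordp_geW (bP _ xS); lia.
(* A proper fraction in [h] is regular at the poles of [h], so only the poles of [z i] remain. *)
apply: ordp_ge_sum => i _; rewrite -[X in ordp_ge x X]add0r; apply: ordp_geM.
  have [->|r0] := eqVneq (p i %% c) 0; first by rewrite poly_at0 mul0r; left.
  move/not_regular: hx => hx.
  have [rh rE] := ordp_poly_at_pole hx r0; have [ch cE] := ordp_poly_at_pole hx c0.
  right; rewrite ordpM ?invr_eq0// ordpV rE cE -mulrBr.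
  have := ltn_modpN0 (p i) c0; move: (size_poly_gt0 (p i %% c)); rewrite r0.
  move: (size _) (size _) => r s r1 rs; nia.
apply: ordp_geW (NP i x); have := leq_bigmax (F := N) i; lia.
Qed.

End StrongApproximation.

(** * The residue theorem *)

Lemma fsum_seq (T : choiceType) (V : nmodType) (f : T -> V) (l : seq T) :
  uniq l -> (forall x, x \notin l -> f x = 0) ->
  \sum_(x \in [set: T]) f x = \sum_(x <- l) f x.
Proof.
move=> ul fl; rewrite [RHS]fsbig_seq//; symmetry.
by apply: fsbig_widen => //= x [_ /= xl]; apply: fl; apply/negP.
Qed.

Lemma sum_triangle (R : pzSemiRingType) (c : nat) (H : nat -> R) :
  \sum_(b < c) \sum_(d < b.+1) H d = \sum_(d < c) (c - d)%:R * H d.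
Proof.
elim: c => [|c IH]; first by rewrite !big_ord0.
rewrite big_ord_recr IH/= [RHS]big_ord_recr big_ord_recr/= subSnn mul1r addrA -big_split/=.
congr (_ + _); apply: eq_bigr => d _.
by rewrite subSn 1?ltnW// -natr1 mulrDl mul1r.
Qed.

Section ResidueTheorem.
Variables (K : closedFieldType) (X : curve K).
Hypothesis K_char0 : [pchar K] =i pred0.
Local Notation F := (ratfun X).
Local Notation cst := (kconst X).
Implicit Types (x y : closed_point X) (f g h : F).

(** * Traces and finite-dimensional spaces of functions *)

Definition klinear (L : F -> K) :=
  (forall f g, L (f + g) = L f + L g) /\ forall c f, L (cst c * f) = c * L f.

Lemma klinearB L f g : klinear L -> L (f - g) = L f - L g.
Proof.
by move=> [LD LZ]; rewrite LD -mulN1r -(rmorph1 cst) -rmorphN LZ mulN1r.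
Qed.

Lemma klinear_sum L (I : Type) (r : seq I) (P : pred I) (f : I -> F) :
  klinear L -> L (\sum_(i <- r | P i) f i) = \sum_(i <- r | P i) L (f i).
Proof.
move=> [LD LZ]; apply: (big_morph L LD).
by rewrite -(mul0r 0) -(rmorph0 cst) LZ mul0r.
Qed.

Lemma klinear_expansion x n : klinear (fun f => expansion x f n).
Proof. by split=> [f g|c f]; rewrite ?expansionD ?expansionZ. Qed.

(** Both f (g v_i) and g (f v_i) give the same diagonal sum. The part passing through the span of
    [v] is symmetric in f and g after exchanging indices, so the parts leaking through [w] must
    agree as well. *)
Lemma trace_commutator (I J : finType) (v : I -> F) (w : J -> F)
    (lam : I -> F -> K) (mu : J -> F -> K) (V : F -> Prop) f g :
  (forall i, klinear (lam i)) ->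
  (forall z, V z -> z = \sum_i cst (lam i z) * v i + \sum_j cst (mu j z) * w j) ->
  (forall i, V (f * v i)) -> (forall i, V (g * v i)) ->
  \sum_i \sum_j mu j (g * v i) * lam i (f * w j) =
  \sum_i \sum_j mu j (f * v i) * lam i (g * w j).
Proof.
move=> lin dec Vf Vg.
have E a b : (forall i, V (b * v i)) -> \sum_i lam i (a * (b * v i)) =
    \sum_i \sum_k lam k (b * v i) * lam i (a * v k) +
    \sum_i \sum_j mu j (b * v i) * lam i (a * w j).
  move=> Vb; rewrite -big_split/=; apply: eq_bigr => i _.
  have [lD lZ] := lin i; rewrite {1}(dec _ (Vb i)) mulrDr lD !mulr_sumr.
  by rewrite !(klinear_sum _ _ _ (lin i)); congr (_ + _); apply: eq_bigr => k _;
    rewrite mulrCA lZ.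
have := E f g Vg; under eq_bigr => i _ do rewrite mulrCA.
rewrite (E g f Vf) [X in X + _ = _]exchange_big/=.
under [X in X + _ = _]eq_bigr => i _ do under eq_bigr => k _ do rewrite mulrC.
by move/addrI.
Qed.

(** The coordinate functionals are linear on the whole function field, because [trace_commutator]
    also applies them to products lying outside the space. *)
Definition finite_coordinates (V : F -> Prop) := exists (n : nat)
  (e : 'I_n -> F) (kap : 'I_n -> F -> K), [/\ forall i, V (e i),
    forall i, klinear (kap i) & forall z, V z -> z = \sum_i cst (kap i z) * e i].

Definition in_divisor_space (D : seq (closed_point X)) f :=
  forall x, ordp_ge x (- (count_mem x D)%:Z) f.

(** Allowing one more pole at [x] adds one coefficient, hence at most one dimension; the induction
    starts from constancy of everywhere regular functions. *)
Lemma divisor_space_finite D : finite_coordinates (in_divisor_space D).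
Proof.
elim: D => [|x D [n [e [kap [De kapL kapE]]]]].
  have [x0 _] := exists_point X.
  exists 1%N, (fun=> 1), (fun=> fun f => expansion x0 f 0); split=> [_ x|i|z zP].
  - exact: ordp_ge1.
  - exact: klinear_expansion.
  - have [c ->] := everywhere_regular_cst zP.
    by rewrite big_ord1 mulr1 -[cst c in RHS]mulr1 expansionZ expansion1 mulr1.
have sub f : in_divisor_space D f -> in_divisor_space (x :: D) f.
  by move=> Df y; apply: ordp_geW (Df y) => /=; lia.
pose lam f := expansion x f (- (count_mem x D).+1%:Z).
have lamP z : in_divisor_space (x :: D) z -> lam z = 0 -> in_divisor_space D z.
  move=> Dz lz y; have [<-|xy] := eqVneq x y; last first.
    by have := Dz y; rewrite /= (negbTE xy) add0n.
  apply: expansion_ge => k kD.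
  have [->|kn] := eqVneq k (- (count_mem x D).+1%:Z); first exact: lz.
  apply: (expansion_lt (Dz x)); rewrite /= eqxx.
  by change (k < - (count_mem x D).+1%:Z); move: kD kn; move: (count_mem x D); lia.
have [[z0 Dz0 lz0]|no] := pselect (exists2 z, in_divisor_space (x :: D) z & lam z != 0);
    last first.
  exists n, e, kap; split=> // [i|z Dz]; first exact: sub.
  apply: kapE; apply: lamP => //; apply/eqP; apply: contrapT => lz; apply: no.
  by exists z => //; apply/negP.
have lamL : klinear lam := klinear_expansion x _.
exists n.+1, (fun i => oapp e (cst (lam z0)^-1 * z0) (unlift ord_max i)),
  (* The old coordinates are applied after projecting along [z0] onto the kernel of [lam]. *)
  (fun i => oapp (fun j z => kap j (z - cst (lam z / lam z0) * z0)) lam (unlift ord_max i)).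
split=> [i|i|z Dz].
- case: (unlift ord_max i) => [j|] /=; first exact: sub.
  by move=> y; apply: ordp_geCl.
- case: (unlift ord_max i) => [j|//] /=; have [kD kZ] := kapL j; have [lD lZ] := lamL.
  split=> [f g|c f].
    by rewrite -kD lD mulrDl rmorphD; congr (kap j _); ring.
  by rewrite -kZ lZ -mulrA rmorphM; congr (kap j _); ring.
- rewrite big_ord_recr/= unlift_none/=.
  have wE j : widen_ord (leqnSn n) j = lift ord_max j.
    by apply: val_inj; rewrite /= /bump leqNgt ltn_ord.
  under eq_bigr => j _ do rewrite wE liftK/=.
  rewrite -kapE; first by rewrite mulrA -rmorphM; ring.
  apply: lamP; last first.
    by rewrite (klinearB _ _ lamL) lamL.2 divfK// subrr.
  by move=> y; apply: ordp_geB => //; exact: ordp_geCl.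
Qed.

(* Trace of the commutator of f and g on the space of functions with poles of
   order at most N + c on S: only basis elements of the last c levels
   contribute, and their products are determined by local expansions. *)
Lemma residue_sum_mul_df (h f g : F) (S : seq (closed_point X)) :
  (forall c, h <> cst c) -> uniq S -> (forall x, x \notin S <-> regular x h) ->
  (forall x, x \notin S -> regular x f) -> (forall x, x \notin S -> regular x g) ->
  \sum_(x <- S) residue x (f *: df g) = 0.
Proof.
move=> hc uS SP fS gS.
have [M MP] := strong_approximation_at_poles hc.
have [c1 c1P] := pole_bound f; have [c2 c2P] := pole_bound g.
pose c := maxn c1 c2.
have fc x : ordp_ge x (- c%:Z) f by apply: ordp_geW (c1P x); rewrite /c; lia.
have gc x : ordp_ge x (- c%:Z) g by apply: ordp_geW (c2P x); rewrite /c; lia.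
(* The uncontrolled poles of the functions [W] below have order at most M; multiplied by f or g they
   reach order N at most. *)
pose N := (M + c)%N.
pose L k z := forall x, ordp_ge x (- (k * (x \in S))%:Z) z.
have LD k a b : L k a -> L k b -> L k (a + b) by move=> la lb x; exact: ordp_geD.
have L_f k z : L k z -> L (k + c)%N (f * z).
  move=> Lz x; have := Lz x; have := fc x; have := fS x; case: (x \in S) => fSx fcx Lzx.
    by apply: ordp_geW (ordp_geM fcx Lzx); lia.
  by apply: ordp_geW (ordp_geM (fSx isT) Lzx); lia.
have L_g k z : L k z -> L (k + c)%N (g * z).
  move=> Lz x; have := Lz x; have := gc x; have := gS x; case: (x \in S) => gSx gcx Lzx.
    by apply: ordp_geW (ordp_geM gcx Lzx); lia.
  by apply: ordp_geW (ordp_geM (gSx isT) Lzx); lia.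
have L_le k k' z : (k <= k')%N -> L k z -> L k' z.
  by move=> kk Lz x; apply: ordp_geW (Lz x); case: (x \in S); lia.
have [p [e [kap [Le kapL kapE]]]] : finite_coordinates (L N).
  suff -> : L N = in_divisor_space (flatten (nseq N S)) by exact: divisor_space_finite.
  apply/funext => z; rewrite /L /in_divisor_space.
  suff E x : count_mem x (flatten (nseq N S)) = (N * (x \in S))%N.
    by apply/propext; split=> Lz x; have := Lz x; rewrite E.
  by rewrite count_flatten map_nseq sumn_nseq count_uniq_mem// mulnC.
(* [W (x, k)] has polar part t^(-k) at x, up to poles of order at most M on [S]. *)
have /choice[W WP] (ie : closed_point X * nat) : exists a,
    (forall x, x \notin S -> regular x a) /\ forall x, x \in S ->
    ordp_ge x (- M%:Z) (a - if x == ie.1 then uniformizer x ^ (- ie.2%:Z) else 0).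
  have [a [aP1 aP2]] := MP (fun x => if x == ie.1 then uniformizer x ^ (- ie.2%:Z) else 0).
  exists a; split=> [x /SP|x xS]; first exact: aP1.
  by apply: aP2 => /SP; rewrite xS.
have LW x k : (M <= k)%N -> L k (W (x, k)).
  move=> Mk y; have [W1 W2] := WP (x, k); have := W1 y; have := W2 y.
  case: (y \in S) => Wy2 Wy1; last by rewrite muln0; exact: Wy1.
  rewrite muln1 -[W _](subrK (if y == x then uniformizer y ^ (- k%:Z) else 0)).
  apply: ordp_geD; first by apply: ordp_geW (Wy2 isT); lia.
  by case: eqP => _; [exact: ordp_ge_uniformizerXz|left].
have coefW x k y b : y \in S -> (M < b)%N ->
    expansion y (W (x, k)) (- b%:Z) = ((y == x) && (b == k))%:R.
  move=> yS Mb; have [_ /(_ y yS) Wy] := WP (x, k).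
  have : expansion y (W (x, k) - if y == x then uniformizer y ^ (- k%:Z) else 0) (- b%:Z) = 0.
    by apply: (expansion_lt Wy); lia.
  rewrite expansionB => /eqP; rewrite subr_eq0 => /eqP ->.
  case: eqP => _ /=; last by rewrite expansion0.
  by rewrite expansionXz eqr_opp eqz_nat.
have coefM u x k y b : (forall z, ordp_ge z (- c%:Z) u) -> y \in S -> (N < b)%N ->
    expansion y (u * W (x, k)) (- b%:Z) =
    if y == x then expansion y u (k%:Z - b%:Z) else 0.
  move=> uc yS Nb; have [_ /(_ y yS) Wy] := WP (x, k).
  rewrite -[W _](subrK (if y == x then uniformizer y ^ (- k%:Z) else 0)).
  rewrite mulrDr expansionD (expansion_lt (ordp_geM (uc y) Wy)) ?add0r; last first.
    by rewrite /N in Nb; lia.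
  case: eqP => _; last by rewrite mulr0 expansion0.
  by rewrite mulrC expansion_shift; congr (expansion y u _); lia.
have [x0 _] := exists_point X.
pose pt (i : 'I_(size S)) := nth x0 S i.
have ptS i : pt i \in S by rewrite mem_nth.
have pt_inj i j : (pt i == pt j) = (i == j) by rewrite /pt nth_uniq.
(* Together with L N, the c levels after N span L (N + c), the compressed space; the next c levels
   receive what multiplication by f or g moves out of it. *)
pose lev1 (b : 'I_c) := (N + 1 + b)%N.
pose lev2 (a : 'I_c) := (N + c + 1 + a)%N.
pose T := ('I_(size S) * 'I_c)%type.
pose w1 (j : T) := W (pt j.1, lev1 j.2).
pose w2 (j : T) := W (pt j.1, lev2 j.2).
pose co1 (j : T) z := expansion (pt j.1) z (- (lev1 j.2)%:Z).
pose co2 (j : T) z := expansion (pt j.1) z (- (lev2 j.2)%:Z).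
(* Removing the coefficients of all 2c levels leaves an element of L N when [z] lies in L (N +
   2c). *)
pose rest z := z - (\sum_j cst (co1 j z) * w1 j + \sum_j cst (co2 j z) * w2 j).
pose v (i : 'I_p + T) := match i with inl i => e i | inr j => w1 j end.
pose lam (i : 'I_p + T) z := match i with inl i => kap i (rest z) | inr j => co1 j z end.
have lamL i : klinear (lam i).
  case: i => [i|j]; last exact: klinear_expansion.
  have [kD kZ] := kapL i; split=> [a b|k a] /=.
    rewrite -kD; congr (kap i _); rewrite /rest.
    have lD (co : T -> F -> K) (w : T -> F) : (forall j, klinear (co j)) ->
        \sum_j cst (co j (a + b)) * w j =
        \sum_j cst (co j a) * w j + \sum_j cst (co j b) * w j.
      move=> coL; rewrite -big_split; apply: eq_bigr => j _ /=.
      by rewrite (coL j).1 rmorphD mulrDl.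
    by rewrite !lD => [|j|j]; [ring|exact: klinear_expansion|exact: klinear_expansion].
  rewrite -kZ; congr (kap i _); rewrite /rest mulrBr mulrDr !mulr_sumr.
  by congr (_ - (_ + _)); apply: eq_bigr => j _;
    rewrite /co1 /co2 expansionZ rmorphM mulrA.
have dec z : L (N + c + c)%N z ->
    z = \sum_i cst (lam i z) * v i + \sum_j cst (co2 j z) * w2 j.
  move=> Lz; rewrite big_sumType/= -kapE; first by rewrite /rest; ring.
  have Lrest : L (N + c + c)%N (rest z).
    have LN u : L (N + c + c)%N u -> L (N + c + c)%N (- u) by move=> Lu x; exact: ordp_geN.
    have Lsum (co : T -> K) (w : T -> F) : (forall j, L (N + c + c)%N (w j)) ->
        L (N + c + c)%N (\sum_j cst (co j) * w j).
      by move=> Lw x; apply: ordp_ge_sum => j _; exact: ordp_geCl (Lw j x).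
    apply: (LD) => //; apply: LN; apply: LD; apply: Lsum => j.
      apply: (@L_le (lev1 j.2)); first by rewrite /lev1; have := ltn_ord j.2; lia.
      by apply: LW; rewrite /lev1 /N; lia.
    apply: (@L_le (lev2 j.2)); first by rewrite /lev2; have := ltn_ord j.2; lia.
    by apply: LW; rewrite /lev2 /N; lia.
  move=> x; have := Lrest x; have [xS|xS] := boolP (x \in S); last by rewrite !muln0.
  rewrite !muln1 => Lx; apply: expansion_ge => k kN.
  have [kl|kl] := ltP k (- (N + c + c)%:Z); first exact: (expansion_lt Lx).
  have [i xE] : exists i, x = pt i.
    have xi : (index x S < size S)%N by rewrite index_mem.
    by exists (Ordinal xi); rewrite /pt nth_index.
  rewrite {x xS Lx}xE in xS Lx *.
  pose b := absz k; have kE : k = - b%:Z by rewrite /b; lia.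
  have Nb : (N < b)%N by lia.
  rewrite expansionB expansionD !expansion_sum kE.
  have coE (lev : 'I_c -> nat) (co : T -> K) :
      \sum_j expansion (pt i) (cst (co j) * W (pt j.1, lev j.2)) (- b%:Z) =
      \sum_(a < c) co (i, a) * (b == lev a)%:R.
    transitivity (\sum_i' \sum_a co (i', a) * ((i == i') && (b == lev a))%:R).
      rewrite pair_bigA; apply: eq_bigr => -[i' a] _ /=.
      by rewrite expansionZ coefW// ?pt_inj//; rewrite /N in Nb; lia.
    rewrite (bigD1 i)//= [X in _ + X]big1 ?addr0.
      by apply: eq_bigr => a _; rewrite eqxx.
    by move=> i' i'i; rewrite big1// => a _; rewrite eq_sym (negbTE i'i) mulr0.
  rewrite (coE lev1 (fun j => co1 j z)) (coE lev2 (fun j => co2 j z)).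
  have [bc|cb] := leqP b (N + c)%N.
    have bl : (b - (N + 1) < c)%N by lia.
    rewrite (bigD1 (Ordinal bl))//= [X in _ + X + _]big1 ?addr0; last first.
      move=> a ab; rewrite (_ : (_ == _) = false) ?mulr0//; apply: contraNF ab => /eqP ab.
      by apply/eqP/val_inj; rewrite /= ab /lev1; lia.
    rewrite [X in _ - (_ + X)]big1 ?addr0; last first.
      by move=> a _; rewrite (_ : (_ == _) = false) ?mulr0// /lev2; lia.
    have lE : lev1 (Ordinal bl) = b by rewrite /lev1 /=; lia.
    by rewrite /co1 /= lE eqxx mulr1 subrr.
  have bl : (b - (N + c + 1) < c)%N by lia.
  rewrite [X in _ - (X + _)]big1 ?add0r; last first.
    by move=> a _; rewrite (_ : (_ == _) = false) ?mulr0// /lev1; have := ltn_ord a; lia.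
  rewrite (bigD1 (Ordinal bl))//= [X in _ - (_ + X)]big1 ?addr0; last first.
    move=> a ab; rewrite (_ : (_ == _) = false) ?mulr0//; apply: contraNF ab => /eqP ab.
    by apply/eqP/val_inj; rewrite /= ab /lev2; lia.
  have lE : lev2 (Ordinal bl) = b by rewrite /lev2 /=; lia.
  by rewrite /co2 /= lE eqxx mulr1 subrr.
have Lv i : L (N + c)%N (v i).
  case: i => [i|j] /=; first by apply: L_le (Le i); lia.
  apply: (@L_le (lev1 j.2)); first by rewrite /lev1; have := ltn_ord j.2; lia.
  by apply: LW; rewrite /lev1 /N; lia.
have := trace_commutator lamL dec (fun i => L_f _ _ (Lv i)) (fun i => L_g _ _ (Lv i)).
(* The sum of n u'_(-n) u_n over n from 1 to c. The residue of f dg splits by the sign of n into two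
   such sums. *)
pose B u u' x := \sum_(d < c) (c - d)%:R *
  (expansion x u' (- (c - d)%N%:Z) * expansion x u (c - d)%N%:Z).
have tr u u' : (forall z, ordp_ge z (- c%:Z) u) -> (forall z, ordp_ge z (- c%:Z) u') ->
    (forall z, L N z -> L (N + c)%N (u' * z)) ->
    \sum_i \sum_j co2 j (u' * v i) * lam i (u * w2 j) = \sum_(x <- S) B u u' x.
  move=> uc uc' Lu'; rewrite big_sumType/= [X in X + _]big1 ?add0r; last first.
    move=> i _; rewrite big1// => j _; rewrite /co2 (expansion_lt (Lu' _ (Le i) _)) ?mul0r//.
    by rewrite ptS /lev2; lia.
  rewrite (big_nth x0) big_mkord.
  transitivity (\sum_i \sum_b \sum_j co2 j (u' * w1 (i, b)) * co1 (i, b) (u * w2 j)).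
    by rewrite [RHS]pair_bigA; apply: eq_bigr => -[i b] _.
  apply: eq_bigr => i _.
  pose G n := expansion (pt i) u' (- n%:Z) * expansion (pt i) u n%:Z.
  (* The two coefficients at levels a and b depend only on the gap c + a - b between them. *)
  transitivity (\sum_(b < c) \sum_(a < c) G (c + a - b)%N).
    apply: eq_bigr => b _.
    transitivity (\sum_k \sum_a co2 (k, a) (u' * w1 (i, b)) * co1 (i, b) (u * w2 (k, a))).
      by rewrite [RHS]pair_bigA; apply: eq_bigr => -[k a] _.
    rewrite (bigD1 i)//= [X in _ + X]big1 ?addr0.
      apply: eq_bigr => a _; rewrite /co1 /co2 /w1 /w2 /= !coefM//; last 2 first.
      - by rewrite /lev1; lia.
      - by rewrite /lev2; lia.
      rewrite eqxx /G; have := ltn_ord b.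
      by move=> bc; congr (_ * _); congr (expansion _ _); rewrite /lev1 /lev2; lia.
    move=> k ki; rewrite big1// => a _.
    rewrite /co2 /w1 coefM//; last by rewrite /lev2 /=; lia.
    by rewrite pt_inj (negbTE ki) mul0r.
  rewrite /B -(sum_triangle c (fun d => G (c - d)%N)); apply: eq_bigr => b _.
  (* For a > b the gap exceeds c, the bound on the poles of u'. Each remaining gap n occurs n
     times. *)
  rewrite (bigID (fun a : 'I_c => (a < b.+1)%N))/= [X in _ + X]big1 ?addr0.
    rewrite (big_ord_narrow (ltn_ord b)) (reindex_inj rev_ord_inj)/=.
    apply: eq_bigr => d _; rewrite /G.
    have := ltn_ord d; have := ltn_ord b => bc db.
    by congr (_ * _); congr (expansion _ _); lia.
  move=> a ab; rewrite /G (expansion_lt (uc' _)) ?mul0r//.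
  by have := ltn_ord b; lia.
rewrite (tr f g)// ?(tr g f)//; [|exact: L_f|exact: L_g] => BE.
suff rE x : residue x (f *: df g) = B g f x - B f g x.
  by rewrite (eq_bigr _ (fun x _ => rE x)) sumrB BE subrr.
rewrite residueE form_coefZ// form_coef_df//.
(* The degrees of f run from -c to c; degree 0 contributes nothing because g' has no term in degree
   -1. *)
rewrite (expansionM (fc x) (ordp_ge_derivative K_char0 (gc x)) (N := (c + c.+1)%N)); last by lia.
rewrite big_split_ord/= big_ord_recl/= !derivativeE//.
rewrite (_ : -1 - (- c%:Z + (c + 0)%N%:Z) + 1 = 0); last by lia.
rewrite mul0r mulr0 add0r /B -sumrN; congr (_ + _).
  apply: eq_bigr => d _; rewrite derivativeE// mulrCA; have := ltn_ord d => dc.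
  rewrite (_ : -1 - (- c%:Z + d%:Z) + 1 = (c - d)%N%:Z); last by lia.
  by rewrite -pmulrn; congr (_ * (_ * _)); congr (expansion _ _); lia.
rewrite (reindex_inj rev_ord_inj)/=; apply: eq_bigr => d _.
rewrite derivativeE//; have := ltn_ord d => dc.
rewrite (_ : -1 - _ + 1 = - (c - d)%N%:Z); last by rewrite /bump; lia.
rewrite mulrNz mulNr mulrN mulrCA [X in _ = - (_ * X)]mulrC -pmulrn.
by congr (- (_ * (_ * _))); congr (expansion _ _); rewrite /bump; lia.
Qed.

(** * The residue theorem for an arbitrary form *)

Lemma residue_finite w : finite_set [set x : closed_point X | residue x w != 0].
Proof.
apply: sub_finite_set (finite_form_poles K_char0 w) => x /= /eqP wx rx.
by apply: wx; exact: residue_regular.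
Qed.

Theorem residue_theorem (w : meroform X) :
  \sum_(x \in [set: closed_point X]) residue x w = 0.
Proof.
have [x0 _] := exists_point X.
set f := form_coef x0 w; set g := uniformizer x0.
have /finite_seqP[T1 T1E] := finite_poles f.
have /finite_seqP[T2 T2E] := finite_poles g.
(* [h] will have a pole at each point of [T], agreeing there with 1/t up to a regular function.
   Including [x0] makes [T] nonempty, hence [h] nonconstant. *)
pose T := undup (x0 :: T1 ++ T2).
have [h hP] := weak_approximation (fun x => (uniformizer x)^-1) 0 (undup_uniq (x0 :: T1 ++ T2)).
have hT x : x \in T -> ~ regular x h.
  move=> xT hx; have := ordp_geB hx (hP x xT); rewrite subKr.
  by move=> /ordp_geE; rewrite invr_eq0 uniformizer_neq0 ordpV ordp_uniformizer => /(_ isT).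
have x0T : x0 \in T by rewrite mem_undup mem_head.
have hc c : h <> cst c by move=> hE; apply: (hT _ x0T); rewrite hE; exact: ordp_ge_cst.
have /finite_seqP[S SE] := finite_poles h.
have SP x : x \notin undup S <-> regular x h.
  rewrite mem_undup; split=> [/negP xS|hx].
    by apply: contrapT => hx; apply: xS; have : [set` S] x by rewrite -SE.
  by apply/negP => xS; have : [set` S] x by []; rewrite -SE.
have offT u (l : seq (closed_point X)) : [set x | ~ regular x u] = [set` l] ->
    {subset l <= T} -> forall x, x \notin undup S -> regular x u.
  move=> lE lT x xS; apply: contrapT => ux.
  have xl : x \in l by have : [set` l] x by rewrite -lE.
  by move/SP: xS; apply: hT; exact: lT.
have fS x : x \notin undup S -> regular x f.
  by apply: (offT _ _ T1E) => y yT; rewrite mem_undup inE mem_cat yT orbT.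
have gS x : x \notin undup S -> regular x g.
  by apply: (offT _ _ T2E) => y yT; rewrite mem_undup inE mem_cat yT !orbT.
have wE : w = f *: df g by rewrite form_coefE.
rewrite wE (@fsum_seq _ _ _ (undup S)) ?undup_uniq//.
  by apply: (residue_sum_mul_df hc) => //; exact: undup_uniq.
move=> x xS; apply: residue_regular => //; apply: form_regularZ; first exact: fS.
by apply: form_regular_df; exact: gS.
Qed.

End ResidueTheorem.

(** * The cup product *)

(** A primitive is only a coefficient sequence, in general not the expansion of a function, so its
    products need their own cutoff. *)
Lemma laurent_mul_sum (K : closedFieldType) (a b : int -> K) (m m' n : int) (N : nat) :
  (forall k, k < m -> a k = 0) -> (forall k, k < m' -> b k = 0) ->
  n < m + N%:Z + m' ->
  laurent_mul a b n = \sum_(k < N) a (m + k%:Z) * b (n - (m + k%:Z)).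
Proof.
move=> am bm nN; rewrite /laurent_mul (@fsum_seq _ _ _ [seq m + k%:Z | k <- iota 0 N]).
- by rewrite big_map -[X in iota _ X]subn0 -/(index_iota 0 N) big_mkord.
- by rewrite map_inj_uniq ?iota_uniq// => i j /addrI[].
move=> k /mapP kN; have [km|mk] := ltP k m; first by rewrite am// mul0r.
rewrite bm ?mulr0// ltNge; apply/negP => h; apply: kN; exists (absz (k - m)).
  by rewrite mem_iota; lia.
by lia.
Qed.

Section CupProduct.
Variables (K : closedFieldType) (X : curve K).
Hypothesis K_char0 : [pchar K] =i pred0.
Local Notation F := (ratfun X).
Local Notation cst := (kconst X).
Implicit Types (x y : closed_point X) (f g h u v : F) (w : meroform X).

(* Integration by parts: for w = df + r and eta = dg + s with r, s regular,
   (int w) eta and f eta - g r differ, up to exact forms, by (int r) s, which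
   is regular, and by f(x) eta, which has no residue. *)
Lemma residue_int_mul x w eta f g : residue x eta = 0 ->
  form_regular x (w - df f) -> form_regular x (eta - df g) ->
  laurent_res (laurent_mul (laurent_int (form_expansion x w)) (form_expansion x eta)) =
  residue x (f *: eta - g *: (w - df f)).
Proof.
move=> eta0 /(form_regularP K_char0) wf /(form_regularP K_char0) etag.
rewrite residueE form_coefD// form_coefN// !form_coefZ//.
rewrite residueE in eta0.
rewrite /laurent_res /form_expansion -/(form_coef x w) -/(form_coef x eta).
set r := form_coef x (w - df f) in wf *; set e := form_coef x eta in eta0 *.
have hE : form_coef x w = derivative x f + r.
  by rewrite -form_coef_df// -form_coefD// addrC subrK.
set h := form_coef x w in hE *.
pose s := form_coef x (eta - df g).
have eE : e = derivative x g + s.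
  by rewrite -form_coef_df// -form_coefD// addrC subrK.
pose B := (absz (x f) + absz (x g) + 1)%N.
have fB : ordp_ge x (- B%:Z) f by apply: ordp_geW (ordp_ge_ordp x f); lia.
have gB : ordp_ge x (- B%:Z) g by apply: ordp_geW (ordp_ge_ordp x g); lia.
have eB : ordp_ge x (- B%:Z - 1) e.
  rewrite eE; apply: ordp_geD; first exact: ordp_ge_derivative.
  by apply: ordp_geW etag; lia.
have hB : ordp_ge x (- B%:Z - 1) h.
  rewrite hE; apply: ordp_geD; first exact: ordp_ge_derivative.
  by apply: ordp_geW wf; lia.
have rB : ordp_ge x (- B%:Z - 1) r by apply: ordp_geW wf; lia.
pose N := (B + B + 3)%N.
rewrite (@laurent_mul_sum _ _ _ (- B%:Z) (- B%:Z - 1) _ N); last 3 first.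
- move=> k kB; rewrite /laurent_int; case: eqP => // _.
  by rewrite (expansion_lt hB) ?mul0r//; lia.
- by move=> k; exact: expansion_lt.
- by rewrite /N; lia.
rewrite expansionB (expansionM fB eB (N := N)); last by rewrite /N; lia.
rewrite [g * r]mulrC (expansionM rB gB (N := N)); last by rewrite /N; lia.
(* The equality holds term by term. For k not 0, the coefficients of the primitive and of eta are
   f_k + r_(k-1) / k and - k g_(-k) + s_(-1-k). The surplus r_(k-1) s_(-1-k) / k vanishes, through s
   if k > 0 and through r if k < 0. *)
rewrite -sumrB; apply: eq_bigr => j _.
rewrite (_ : - B%:Z - 1 + j%:Z = - B%:Z + j%:Z - 1); last by lia.
set k := - B%:Z + j%:Z; rewrite (_ : -1 - (k - 1) = - k); last by lia.
(* At k = 0 the primitive has coefficient 0, eta has no residue and r has no polar part. *)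
rewrite /laurent_int; have [->|k0] := eqVneq k 0.
  rewrite mul0r subr0 eta0 mulr0 [X in _ - X * _](expansion_lt wf) ?mul0r ?subr0//.
have kK : k%:~R != 0 :> K by rewrite intr_eq0_pchar0.
rewrite hE expansionD derivativeE// subrK eE expansionD derivativeE//.
rewrite (_ : -1 - k + 1 = - k); last by lia.
have [k1|k1] := ltP 0 k.
  rewrite [expansion x s _](expansion_lt etag); last by lia.
  by rewrite intrN; field.
rewrite [expansion x r _](expansion_lt wf); last by lia.
by field.
Qed.

(** * Sums of residues, classes and the trace *)

Lemma fsum_residueD (F1 F2 : closed_point X -> K) :
  finite_set [set x | F1 x != 0] -> finite_set [set x | F2 x != 0] ->
  \sum_(x \in [set: closed_point X]) (F1 x + F2 x) =
  \sum_(x \in [set: closed_point X]) F1 x + \sum_(x \in [set: closed_point X]) F2 x.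
Proof.
move=> /finite_seqP[l1 l1E] /finite_seqP[l2 l2E].
pose l := undup (l1 ++ l2).
have off (G : closed_point X -> K) (l' : seq (closed_point X)) : [set x | G x != 0] = [set` l'] ->
    {subset l' <= l} -> forall x, x \notin l -> G x = 0.
  move=> lE sub x xl; apply/eqP/negPn/negP => Gx; move/negP: xl; apply; apply: sub.
  by have : [set` l'] x by rewrite -lE.
have F1l := off _ _ l1E; have F2l := off _ _ l2E.
have {}F1l x : x \notin l -> F1 x = 0.
  by apply: F1l => y yl; rewrite mem_undup mem_cat yl.
have {}F2l x : x \notin l -> F2 x = 0.
  by apply: F2l => y yl; rewrite mem_undup mem_cat yl orbT.
rewrite !(@fsum_seq _ _ _ l) ?undup_uniq ?big_split// => x xl.
by rewrite F1l// F2l// addr0.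
Qed.

(** The form in which the residue theorem is applied: one global form may be added at all points at
    once. *)
Lemma fsum_residue_form (c : closed_point X -> K) w :
  finite_set [set x | c x != 0] ->
  \sum_(x \in [set: closed_point X]) (c x + residue x w) =
  \sum_(x \in [set: closed_point X]) c x.
Proof.
move=> cfin; rewrite fsum_residueD ?residue_theorem ?addr0//.
exact: residue_finite.
Qed.

Lemma cocycle2_residue_finite (c : cocycle2 X) : finite_set [set x | residue x (c x) != 0].
Proof.
apply: sub_finite_set (pp2_finite c) => x /= /eqP cx rx.
by apply: cx; exact: residue_regular.
Qed.

Lemma cohomologous1P (z z' : cocycle1 X) :
  \pi_(HdR1 X) z = \pi_(HdR1 X) z' -> cohomologous1 z z'.
Proof. by move/eqmodP => /asboolP. Qed.

Lemma cohomologous2P (c c' : cocycle2 X) :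
  \pi_(HdR2 X) c = \pi_(HdR2 X) c' -> cohomologous2 c c'.
Proof. by move/eqmodP => /asboolP. Qed.

Lemma dR_trace_pi (c : cocycle2 X) :
  dR_trace (\pi_(HdR2 X) c) = - \sum_(x \in [set: closed_point X]) residue x (c x).
Proof.
rewrite /dR_trace; congr (- _); set c' := repr _.
have [g [s [gfin gs]]] : cohomologous2 c c' by apply: cohomologous2P; rewrite reprK.
rewrite -(fsum_residue_form (- s) (cocycle2_residue_finite c')).
apply: eq_fsbigr => x _; apply/eqP.
rewrite -subr_eq0 addrAC -residueB// -residueD// -oppr_eq0 -residueN//.
have := residue_regular K_char0 (gs x); rewrite !residueB// residue_df// sub0r.
by rewrite !residueN// residueD// residueN// residueB// => <-; apply/eqP; ring.
Qed.

Lemma second_kind_cocycle1 w : second_kind w -> exists z : cocycle1 X, form1 z = w.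
Proof.
(* Taking 0 wherever [w] is regular ensures that almost all lifts are regular. *)
move=> ws; have /choice[f fP] x : exists f, form_regular x (df f - w) /\
    (form_regular x w -> f = 0).
  have [wx|wx] := pselect (form_regular x w).
    by exists 0; split=> //; rewrite df0 sub0r; exact: form_regularN.
  by have [f fx] := local_primitive K_char0 (ws x); exists f.
have fin : finite_set [set x | ~ regular x (f x)].
  apply: sub_finite_set (finite_form_poles K_char0 w) => x /= fx wx.
  by apply: fx; rewrite (fP x).2//; left.
by exists (Cocycle1 fin (fun x => (fP x).1)).
Qed.

Lemma dR_classP w : second_kind w ->
  exists2 z : cocycle1 X, form1 z = w & dR_class w = \pi_(HdR1 X) z.
Proof.
move=> /second_kind_cocycle1[z zw].
have : [set \pi_(HdR1 X) z | z in [set z : cocycle1 X | form1 z = w]] (dR_class w).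
  by apply: xgetPex; exists (\pi_(HdR1 X) z); exists z.
by case=> z' z'w <-; exists z'.
Qed.

(** The two open sets are those where [h], respectively 1/h, is regular; strong approximation off
    the poles realizes any principal parts on each. *)
Lemma exists_affine_cover : exists U : affine_cover X, forall g : closed_point X -> F,
  finite_set [set x | ~ regular x (g x)] ->
  exists u : 'I_(cover_size U) -> F, forall i x, U i x -> regular x (u i - g x).
Proof.
have [x0 _] := exists_point X; pose h := uniformizer x0.
have hc c : h <> cst c.
  by move=> hE; have := ordp_uniformizer x0; rewrite -/h hE ordpC.
have hVc c : h^-1 <> cst c.
  by move=> /(congr1 (fun z => z^-1)); rewrite invrK -fmorphV; exact: hc.
pose k (i : 'I_2) : F := if i == 0 then h else h^-1.
have kc i c : k i <> cst c by rewrite /k; case: ifP => _.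
have fin i : finite_set (~` [set x : closed_point X | regular x (k i)]).
  exact: finite_poles.
have prop i : [set x : closed_point X | regular x (k i)] != setT.
  apply/eqP => kT; have [x xk] := exists_pole (kc i).
  have : regular x (k i) by have : [set: closed_point X] x by []; rewrite -kT.
  by apply/not_regular.
have cov x : exists i, regular x (k i).
  have [xh|xh] := leP 0 (x h); first by exists 0; rewrite /k eqxx; right.
  by exists 1; rewrite /k /=; right; rewrite ordpV; lia.
exists (AffineCover fin prop cov) => g gfin.
have /choice[u uP] i := strong_approximation_off_poles (kc i) gfin.
by exists u.
Qed.

Lemma cech1_exists (U : affine_cover X) (z : cocycle1 X)
    (u : 'I_(cover_size U) -> F) :
  (forall i x, U i x -> regular x (u i - - pp1 z x)) ->
  exists a : cech1 U, (forall i, cech1_form a i = form1 z + df (u i)) /\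
    forall i j, cech1_fun a i j = u j - u i.
Proof.
move=> uz.
have reg i x : U i x -> form_regular x (form1 z + df (u i)).
  move=> ix; rewrite (_ : _ + _ = df (u i - - pp1 z x) - (df (pp1 z x) - form1 z)).
    apply: form_regularB; last exact: cocycle1P.
    by apply: form_regular_df; exact: uz.
  by rewrite opprK dfD opprB addrACA subrr addr0 addrC.
have freg i j x : U i x -> U j x -> regular x (u j - u i).
  move=> ix jx; rewrite (_ : _ - _ = (u j - - pp1 z x) - (u i - - pp1 z x)); last by ring.
  by apply: regularB; exact: uz.
have form_coc i j : form1 z + df (u j) - (form1 z + df (u i)) = df (u j - u i).
  by rewrite opprD addrACA subrr add0r dfB.
have fun_coc i j k : u k - u j - (u k - u i) + (u j - u i) = 0 by ring.
by exists (Cech1 reg freg form_coc fun_coc).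
Qed.

(** Reduces identities between forms to identities in the function field. *)
Lemma form_coef_inj x w w' : form_coef x w = form_coef x w' -> w = w'.
Proof. by move=> ww; rewrite -(form_coefE K_char0 x w) ww form_coefE. Qed.

(** With meromorphic cochains allowed, the cup product becomes a coboundary up to exact forms, so
    its class is carried by the principal parts of the forms in parentheses. *)
Lemma cup_form_split (U : affine_cover X) (a b : cech1 U) w eta
    (u v : 'I_(cover_size U) -> F) i j :
  cech1_form a i = w + df (u i) -> cech1_form b j = eta + df (v j) ->
  cech1_fun a i j = u j - u i -> cech1_fun b i j = v j - v i ->
  cup_form a b i j =
  (- (v j *: w) + u j *: eta + u j *: df (v j)) -
  (- (v i *: w) + u i *: eta + u i *: df (v i)) - df (u i * (v j - v i)).
Proof.
move=> ai bj aij bij; rewrite /cup_form ai bj aij bij; have [x0 _] := exists_point X.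
apply: (@form_coef_inj x0).
by rewrite dfM dfB !(form_coefD, form_coefN, form_coefZ)//; ring.
Qed.

(* The class of the cup product is that of s_i - dg_{i,x}, for the lifts
   s_i = - v_i w + u_i eta + u_i dv_i and g_{i,x} = - f_x (v_i + g_x), where
   u_i and v_i are congruent to - f_x and - g_x on U_i. *)
Lemma dR_cup_represented (z1 z2 : cocycle1 X) : exists U (a b : cech1 U) (c : HdR2 X),
  [/\ cech1_represents a (\pi_(HdR1 X) z1), cech1_represents b (\pi_(HdR1 X) z2)
    & cech2_represents (cech_cup a b) c].
Proof.
have [U UP] := exists_affine_cover.
have ppN (z : cocycle1 X) : finite_set [set x | ~ regular x (- pp1 z x)].
  apply: sub_finite_set (pp1_finite z) => x /= zx zx'; apply: zx; exact: regularN.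
have [u uP] := UP _ (ppN z1); have [v vP] := UP _ (ppN z2).
have [a [aF af]] := cech1_exists uP; have [b [bF bf]] := cech1_exists vP.
have rep (z : cocycle1 X) (q : 'I_(cover_size U) -> F) (d : cech1 U) :
    (forall i x, U i x -> regular x (q i - - pp1 z x)) ->
    (forall i, cech1_form d i = form1 z + df (q i)) ->
    (forall i j, cech1_fun d i j = q j - q i) -> cech1_represents d (\pi_(HdR1 X) z).
  move=> qP dF df'; exists z => //; exists q; split=> // [i x ix|i].
    rewrite (_ : _ - _ = - (q i - - pp1 z x)); last by ring.
    by apply: regularN; exact: qP.
  by rewrite dF addrC addKr.
pose s i : meroform X := - (v i *: form1 z1) + u i *: form1 z2 + u i *: df (v i).
pose p i j := u i * (v j - v i).
pose g i (x : closed_point X) := - pp1 z1 x * (v i - - pp1 z2 x).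
have cupE i j : cup_form a b i j = s j - s i - df (p i j).
  exact: (cup_form_split (aF i) (bF j) (af i j) (bf i j)).
(* The expression is -(u_i + f_x)(v_j - v_i), where the first factor is regular on U_i and the
   second on the intersection. *)
have gp i j x : U i x -> U j x -> regular x (g j x - g i x - p i j).
  move=> ix jx; rewrite (_ : _ - _ - _ = - ((u i - - pp1 z1 x) * (v j - v i))).
    apply: regularN; apply: regularM; first exact: uP.
    by rewrite -bf; exact: cech1_fun_regular.
  by rewrite /g /p; ring.
have sg i j x : U i x -> U j x ->
    form_regular x (s j - df (g j x) - (s i - df (g i x))).
  move=> ix jx; rewrite (_ : _ - _ - _ = cup_form a b i j - df (g j x - g i x - p i j)).
    by apply: form_regularB; [exact: cup_form_regular|apply: form_regular_df; exact: gp].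
  have [x0 _] := exists_point X; apply: (@form_coef_inj x0).
  by rewrite cupE !dfB !(form_coefD, form_coefN, form_coefZ)//; ring.
(* By [sg] another choice of index changes the local form only by a regular one. *)
have /choice[ix ixP] x : exists i, U i x := cover_covers U x.
pose c x := s (ix x) - df (g (ix x) x).
have gfin i : finite_set [set x | U i x /\ ~ regular x (g i x)].
  apply: sub_finite_set (pp1_finite z1) => x /= [iUx gx] fx; apply: gx.
  by apply: regularM; [exact: regularN|exact: vP].
have cfin : finite_set [set x | ~ form_regular x (c x)].
  have fin : finite_set ((\bigcup_(i in [set: 'I_(cover_size U)]) [set x | ~ form_regular x (s i)])
      `|` \bigcup_(i in [set: 'I_(cover_size U)]) [set x | U i x /\ ~ regular x (g i x)]).
    rewrite finite_setU; split; apply: bigcup_finite => // i _.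
    exact: finite_form_poles.
  apply: sub_finite_set fin => x /= cx.
  have [sx|sx] := pselect (form_regular x (s (ix x))); last by left; exists (ix x).
  right; exists (ix x) => //; split; first exact: ixP.
  by move=> gx; apply: cx; apply: form_regularB => //; exact: form_regular_df.
exists U, a, b, (\pi_(HdR2 X) (Cocycle2 cfin)); split; first exact: rep uP aF af.
  exact: rep vP bF bf.
exists (Cocycle2 cfin) => //; exists g, s, p; split=> //; split=> //.
  move=> i x iUx /=; rewrite (_ : _ - _ = s i - df (g i x) - c x); first exact: sg.
  by rewrite [LHS]addrC; congr (_ - _); rewrite opprB.
by move=> i j k /=; rewrite /cup_fun af bf /p; ring.
Qed.

(** [dR_cup] is a choice, so once some representation is known to exist, the covering and the
    cocycles behind the chosen value are arbitrary. *)
Lemma dR_cupP (z1 z2 : cocycle1 X) : exists U (a b : cech1 U),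
  [/\ cech1_represents a (\pi_(HdR1 X) z1), cech1_represents b (\pi_(HdR1 X) z2)
    & cech2_represents (cech_cup a b) (dR_cup (\pi_(HdR1 X) z1) (\pi_(HdR1 X) z2))].
Proof.
have [U0 [a0 [b0 [c0 c0P]]]] := dR_cup_represented z1 z2.
have := @xgetPex _ (\pi_(HdR2 X) (zero_cocycle2 X)) [set c | exists U (a b : cech1 U),
  [/\ cech1_represents a (\pi_(HdR1 X) z1), cech1_represents b (\pi_(HdR1 X) z2)
    & cech2_represents (cech_cup a b) c]].
by apply; exists c0, U0, a0, b0.
Qed.

End CupProduct.

Theorem theoremA5 (K : closedFieldType) (K_char0 : [pchar K] =i pred0)
    (X : curve K) (omega eta : meroform X)
    (omega_second_kind : second_kind omega)
    (eta_second_kind : second_kind eta) :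
  dR_trace (dR_cup (dR_class omega) (dR_class eta)) =
  \sum_(x \in [set: closed_point X])
    laurent_res (laurent_mul (laurent_int (form_expansion x omega))
                             (form_expansion x eta)).
Proof.
have [z1 z1E ->] := dR_classP K_char0 omega_second_kind.
have [z2 z2E ->] := dR_classP K_char0 eta_second_kind.
have [U [a [b [[z1' z1z [u [uP aF af]]] [z2' z2z [v [vP bF bf]]] [c -> H]]]]] :=
  dR_cupP K_char0 z1 z2.
have [phi [_ phiE]] := cohomologous1P z1z.
have [psi [_ psiE]] := cohomologous1P z2z.
move: H => [g [s [p [_ [sP _ cupE _]]]]].
rewrite z1E in phiE; rewrite z2E in psiE.
have aE i : cech1_form a i = form1 z1' + df (u i) by rewrite -aF addrC subrK.
have bE i : cech1_form b i = form1 z2' + df (v i) by rewrite -bF addrC subrK.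
have omegaE : omega = form1 z1' + df phi by rewrite -phiE addrC subrK.
have etaE : eta = form1 z2' + df psi by rewrite -psiE addrC subrK.
pose sig i : meroform X := - (v i *: form1 z1') + u i *: form1 z2' + u i *: df (v i).
have [x0 _] := exists_point X; have [i0 _] := cover_covers U x0.
(* Collects the discrepancies that do not depend on the index i: the changes [phi] and [psi] of
   cocycles, and the part of [s] not explained by [sig]. *)
pose theta : meroform X :=
  phi *: eta - psi *: form1 z1' + (s i0 - sig i0).
rewrite dR_trace_pi//.
have cfin := cocycle2_residue_finite K_char0 c.
have -> : - \sum_(x \in [set: closed_point X]) residue x (c x) =
    \sum_(x \in [set: closed_point X]) - residue x (c x).
  have /finite_seqP[l lE] := cfin.
  have lP x : x \notin undup l -> residue x (c x) = 0.
    rewrite mem_undup => /negP xl; apply/eqP/negPn/negP => cx; apply: xl.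
    by have : [set` l] x by rewrite -lE.
  rewrite !(@fsum_seq _ _ _ (undup l)) ?undup_uniq// ?sumrN// => x /lP ->.
  by rewrite oppr0.
rewrite -[LHS](fsum_residue_form K_char0 theta); last first.
  by apply: sub_finite_set cfin => x /=; rewrite oppr_eq0.
apply: eq_fsbigr => x _.
have [i ix] := cover_covers U x.
have af0 : form_regular x (omega - df (phi - u i)).
  rewrite (_ : _ - _ = cech1_form a i); first exact: cech1_form_regular.
  by rewrite omegaE aE dfB opprB addrACA subrr addr0.
have bg0 : form_regular x (eta - df (psi - v i)).
  rewrite (_ : _ - _ = cech1_form b i); first exact: cech1_form_regular.
  by rewrite etaE bE dfB opprB addrACA subrr addr0.
rewrite (residue_int_mul K_char0 (eta_second_kind x) af0 bg0).
have -> : residue x (c x) = residue x (s i).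
  apply/eqP; rewrite -subr_eq0 -oppr_eq0.
  have := residue_regular K_char0 (sP i x ix).
  rewrite !residueB// residueN// residue_df// sub0r opprK => <-.
  by apply/eqP; ring.
have cE := cup_form_split K_char0 (aE i0) (bE i) (af i0 i) (bf i0 i).
(* Both families have the cup product as Čech difference up to exact forms, so s - sig changes only
   by an exact form with the index. *)
have : residue x (s i - sig i) = residue x (s i0 - sig i0).
  apply/eqP; rewrite -subr_eq0 -residueB//; apply/eqP.
  rewrite (_ : _ - _ = df (p i0 i - u i0 * (v i - v i0))) ?residue_df//.
  have := cupE i0 i; rewrite /= cE -/(sig i) -/(sig i0) dfB => E.
  apply: (@form_coef_inj _ _ K_char0 x).
  have := congr1 (form_coef x) E.
  rewrite !(form_coefD, form_coefN)// => {}E.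
  apply/eqP; rewrite -subr_eq0; apply/eqP.
  move/eqP: E; rewrite -subr_eq0 => /eqP E.
  by rewrite -[RHS]oppr0 -[in RHS]E; ring.
rewrite residueB// => sE.
rewrite /theta residueD// -sE.
apply/eqP; rewrite -subr_eq0 -!residueN// -!residueD//; apply/eqP.
(* What is left on comparing with the integration by parts for phi - u_i and psi - v_i is exact. *)
rewrite [X in residue x X](_ : _ = df (u i * psi - u i * v i)) ?residue_df//.
apply: (@form_coef_inj _ _ K_char0 x).
by rewrite etaE omegaE /sig !(dfB, dfD, dfM) !(form_coefD, form_coefN, form_coefZ)//; ring.
Qed.
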